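(* Let $d\ge1$. For any $\mu,\tilde\mu,\nu,\tilde\nu\in\mathcal{P}_2(\mathbb{R}^d)$, $$W_2\big(\mathscr{P}^{cx}_{\preceq\nu}(\mu),\mathscr{P}^{cx}_{\preceq\tilde\nu}(\tilde\mu)\big)\le W_2(\mu,\tilde\mu)+\sqrt{\big(W_2(\mu,\nu)+W_2(\mu,\tilde\nu)\big)\,W_2(\nu,\tilde\nu)}.$$
   Context: $\mathcal{P}_2(\mathbb{R}^d)$ is the set of Borel probability measures on $\mathbb{R}^d$ with finite second moment, and $W_2$ is the 2-Wasserstein distance, $W_2^2(\rho,\nu)=\inf_{\pi\in\Pi(\rho,\nu)}\int|x-y|^2\,d\pi(x,y)$, with $\Pi(\rho,\nu)$ the set of couplings of $\rho$ and $\nu$. Convex order: $\mu\preceq\nu$ means $\int\varphi\,d\mu\le\int\varphi\,d\nu$ for every convex $\varphi:\mathbb{R}^d\to\mathbb{R}$. Backward projection: $\mathscr{P}^{cx}_{\preceq\nu}(\mu):=\operatorname{argmin}_{\rho\preceq\nu}W_2^2(\rho,\mu)$, which is known to exist uniquely for all $\mu,\nu\in\mathcal{P}_2(\mathbb{R}^d)$. *)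

(* Defs.v *)
From HB Require Import structures.
From mathcomp Require Import all_boot all_order all_algebra.
From mathcomp Require Import all_classical all_reals all_analysis.
Import Order.TTheory GRing.Theory Num.Theory.
Import numFieldNormedType.Exports.

Set Implicit Arguments.
Unset Strict Implicit.
Unset Printing Implicit Defensive.

Local Open Scope classical_set_scope.
Local Open Scope ring_scope.
Local Open Scope ereal_scope.

(* R^d with its Borel sigma-algebra. The underlying type is 'rV[R]_d, whose
   vector space structure has to be recovered by annotating with 'rV[R]_d. *)
Definition euclid (R : realType) (d : nat) : measurableType _ :=
  g_sigma_algebraType (@open 'rV[R]_d).

(* Squared Euclidean norm: the library's norm on 'rV[R]_d is the sup norm. *)
Definition sqnorm (R : realType) (d : nat) (x : 'rV[R]_d) : R :=
  (\sum_(i < d) (x ord0 i) ^+ 2)%R.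

Definition P2 (R : realType) (d : nat) : set (probability (euclid R d) R) :=
  [set mu : probability (euclid R d) R |
    \int[mu]_x (sqnorm (x : 'rV[R]_d))%:E < +oo].

(* The marginals are compared on measurable sets only: the values of a measure
   on other sets are irrelevant. *)
Definition couplings (R : realType) (d : nat)
    (rho nu : probability (euclid R d) R) :
    set (probability (euclid R d * euclid R d)%type R) :=
  [set pi | forall A : set (euclid R d), measurable A ->
    pushforward pi fst A = rho A /\ pushforward pi snd A = nu A].

Definition transport_cost (R : realType) (d : nat)
    (pi : probability (euclid R d * euclid R d)%type R) : \bar R :=
  \int[pi]_z (sqnorm ((z.1 : 'rV[R]_d) - (z.2 : 'rV[R]_d)))%:E.

Definition W2sq (R : realType) (d : nat)
    (rho nu : probability (euclid R d) R) : \bar R :=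
  ereal_inf [set transport_cost pi | pi in couplings rho nu].

(* Extended-real valued, and finite on P2; no truncation of +oo takes place. *)
Definition W2 (R : realType) (d : nat)
    (rho nu : probability (euclid R d) R) : \bar R :=
  sqrte (W2sq rho nu).

(* For measures in P2 the integral of a convex function is well defined in
   ]-oo, +oo], since such a function is bounded below by an affine one. *)
Definition convex_order (R : realType) (d : nat)
    (mu nu : probability (euclid R d) R) : Prop :=
  forall phi : 'rV[R]_d -> R,
    convex_function [set: convex_lmodType 'rV[R]_d] phi ->
    \int[mu]_x (phi x)%:E <= \int[nu]_x (phi x)%:E.

Definition argmin (R : realType) (T : Type) (A : set T) (f : T -> \bar R) :
    set T :=
  [set x | A x /\ forall y, A y -> f x <= f y].

(* The set of minimizers; it is a singleton, up to equality of measures on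
   measurable sets, whenever mu and nu are in P2. *)
Definition backward_projection (R : realType) (d : nat)
    (nu mu : probability (euclid R d) R) : set (probability (euclid R d) R) :=
  argmin [set rho | P2 rho /\ convex_order rho nu] (fun rho => W2sq rho mu).

(* Main.v *)
From HB Require Import structures.
Require Import Defs.
From mathcomp Require Import all_boot all_order all_algebra.
From mathcomp Require Import all_classical all_reals all_analysis.
From mathcomp Require Import measurable_realfun ring lra.
Import Order.TTheory GRing.Theory Num.Theory.
Import numFieldNormedType.Exports.

Set Implicit Arguments.
Unset Strict Implicit.
Unset Printing Implicit Defensive.

Local Open Scope classical_set_scope.
Local Open Scope ring_scope.

(** Lift measures to square-integrable random vectors. If X has law mu, the
    vectors whose law is below nu in convex order form a convex subset of L2:
    a convex test function sees an interpolation of Z and V through the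
    interpolation of its values (convex_order_interpolation). The backward
    projection of mu is therefore the law of the Hilbert projection Z of X, and
    <X - Z, V - Z> <= 0 for every V of law nu (projection_variational).

    Put Z, X, X', Z' of laws rho, mu, mu', rho' on one space, the consecutive
    pairs being optimally coupled. Then
      |Z - Z'|^2 = <X - Z, Z' - Z> + <X - X', Z - Z'> + <X' - Z', Z - Z'>.
    The middle term is at most W2(mu, mu') |Z - Z'|. In the first term the law
    of Z' is below nu', not below nu, but
      <X - Z, Z' - Z> <= |X - Z| W2(nu, nu')       (projection_cross_inequality)
    and the last term is symmetric. Write a = |Z - Z'|, D = W2(mu, mu'),
    e = W2(nu, nu') and S = W2(mu, nu) + W2(mu, nu'). As
    |X - Z| <= W2(mu, nu) and |X' - Z'| <= W2(mu', nu') <= D + W2(mu, nu'),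
    this gives a^2 <= D a + e (S + D), and since e <= S the root of this
    quadratic inequality is at most D + sqrt (e S) (projection_stability).

    The cross inequality rests on the following: for rho' below nu' and any
    random vector p, the correlation E<p, Z'> with a vector of law rho' is at
    most the supremum of E<p, Y'> over vectors Y' of law nu'. A Y' of law nu'
    is then exchanged for a V of law nu at the price |p| W2(nu, nu'), and the
    variational inequality applies, with p = X - Z. For p with finitely many values this
    is Kantorovich duality: the dual potential is convex, so its integral grows
    from rho' to nu'. Replacing the maximum of affine functions in the potential
    by a log-sum-exp makes the dual functional smooth; its minimizer is found by
    compactness, the first-order condition says that the softmax weights have
    the right marginals, and these weights are the conditional law of the value
    of p given Y' (soft_assignment). The smoothing error depends on the number
    of values only, so that it becomes relatively small when p is multiplied by
    a large factor.

    Optimal couplings, disintegration and martingale couplings are avoided: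
    couplings are optimal up to eta, random vectors are approximated in L2 by
    finite-valued ones (discretize), and gluing is done conditionally on the
    finitely many values (glue_soft, approximate_gluing), all errors tending
    to 0. *)

(** * Linear arithmetic of the error estimates *)

Section real_bounds.
Context {R : realFieldType}.
Implicit Types x A D delta err eps eta : R.

Lemma telescoped_bound x1 x2 x3 x4 x5 x6 A D delta err (M1 M2 : R) :
  x1 <= x2 + delta * M1 -> x2 <= x3 + delta -> x3 <= x4 + delta * M2 ->
  x4 <= x5 + A * (D + delta) -> x5 <= x6 + err ->
  x1 - x6 <= A * D + err + delta * (M1 + M2 + A + 1).
Proof. lra. Qed.

Lemma three_step_bound x x1 x2 x3 x4 D eta :
  x <= x1 + x2 -> x2 <= x3 + x4 -> x1 <= eta -> x3 <= D + eta -> x4 <= eta ->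
  x <= D + 3 * eta.
Proof. lra. Qed.

Lemma quadratic_bound x1 x2 x3 A1 A2 a D D1 D2 eps eta (K1 K2 : R) :
  0 <= eps -> x1 <= A1 * eps + eta * K1 -> x3 <= A2 * eps + eta * K2 ->
  x2 <= (D + 3 * eta) * a -> A1 <= D1 + eta -> A2 <= D + D2 + eta ->
  x1 + x2 + x3 <=
    (D + 3 * eta) * a + eps * (D1 + D2 + D) + eta * (K1 + K2 + 2 * eps).
Proof.
move=> e0 h1 h3 h2 hA1 hA2.
by have := ler_wpM2r e0 hA1; have := ler_wpM2r e0 hA2; lra.
Qed.

Lemma triangle_bound x x1 x2 x3 x4 D1 D2 eps :
  x <= x1 + x2 -> x2 <= x3 + x4 -> x1 <= D1 + eps / 3 -> x3 <= eps / 3 ->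
  x4 <= D2 + eps / 3 -> x <= D1 + D2 + eps.
Proof. lra. Qed.

Lemma shift_bound x1 x2 x3 delta :
  x1 <= x2 + - delta -> x1 + (x3 + delta) <= x2 + x3.
Proof. lra. Qed.

Lemma increment_bound x1 x2 x3 x4 x5 :
  x1 + x3 <= x2 + (x3 + x5) -> x2 <= x1 + x4 -> 0 <= x4 + x5.
Proof. lra. Qed.

End real_bounds.

(** * Borel measurability in Euclidean space *)

Section euclid_measurability.
Context {R : realType} {d : nat}.
Implicit Types x y : 'rV[R]_d.

Lemma continuous_measurable_euclid (f : 'rV[R]_d -> R) :
  continuous f -> measurable_fun setT (f : euclid R d -> R).
Proof.
move=> cf.
apply: (measurability _ (RGenOpens.measurableE R)).
move=> _ [_ [a [b ->]] <-]; rewrite setTI; apply: sub_sigma_algebra.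
by apply: open_comp => // + _; exact: cf.
Qed.

Lemma measurable_coord (i : 'I_d) :
  measurable_fun setT (fun x : euclid R d => (x : 'rV[R]_d) ord0 i).
Proof. by apply: continuous_measurable_euclid; exact: coord_continuous. Qed.

Definition rat_point (q : 'rV[rat]_d) : 'rV[R]_d := map_mx ratr q.

Lemma rat_point_dense x (e : R) : 0 < e ->
  exists q, forall i, `|x ord0 i - rat_point q ord0 i| < e.
Proof.
move=> e0.
have /choice[q qP] : forall i : 'I_d, exists q : rat,
    `|x ord0 i - ratr q| < e.
  move=> i; have /rat_in_itvoo[q] : x ord0 i - e < x ord0 i + e by lra.
  rewrite in_itv/= => /andP[q1 q2]; exists q.
  by rewrite ltr_norml; apply/andP; split; lra.
by exists (\row_i q i) => i; rewrite !mxE.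
Qed.

Context {dT} {T : measurableType dT}.

(** Rational boxes form a countable base of the topology, so Borel
    measurability of a vector-valued map can be tested coordinatewise. *)
Lemma measurable_to_euclid (X : T -> 'rV[R]_d) :
  (forall i, measurable_fun setT (fun t => X t ord0 i)) ->
  measurable_fun setT (X : T -> euclid R d).
Proof.
move=> mX; apply: (@measurability _ _ _ (euclid R d) _ _ (@open 'rV[R]_d) erefl).
move=> _ [U oU <-]; rewrite setTI.
pose box (a : 'rV[rat]_d * nat) : set 'rV[R]_d :=
  [set y | forall i, `|y ord0 i - rat_point a.1 ord0 i| < a.2.+1%:R^-1].
have boxE : U = \bigcup_(a in [set a | box a `<=` U]) box a.
  apply/seteqP; split; last by move=> y [a aU ay]; exact: aU.
  move=> x Ux; have /nbhs_ballP[e /= e0 eU] := open_nbhs_nbhs (conj oU Ux).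
  have /ltr_add_invr[k ke] : 0 < e / 2 by lra.
  rewrite add0r in ke.
  have k0 : (0 : R) < k.+1%:R^-1 by rewrite invr_gt0 ltr0n.
  have [q qx] := rat_point_dense x k0.
  exists (q, k) => //= y yq; apply: eU; split => // i j.
  rewrite (ord1 i) -[ball _ _ _]/(is_true (`|x ord0 j - y ord0 j| < e)).
  apply: (le_lt_trans (ler_distD (rat_point q ord0 j) _ _)).
  rewrite [e]splitr ltrD//; first exact: lt_trans (qx j) ke.
  by rewrite distrC; exact: lt_trans (yq j) ke.
have -> : X @^-1` U =
    \bigcup_(a in [set a | box a `<=` U]) (X @^-1` box a).
  by rewrite [in LHS]boxE preimage_bigcup.
rewrite bigcup_mkcond; apply: countable_bigcupT_measurable => // a.
case: ifP => // _.
have -> : X @^-1` box a = \bigcap_(i in [set: 'I_d])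
    [set t | `|X t ord0 i - rat_point a.1 ord0 i| < a.2.+1%:R^-1].
  by apply/seteqP; split=> [t Xt i _|t Xt i]; [exact: Xt|exact: Xt].
apply: fin_bigcap_measurable => // i _; rewrite -[X in measurable X]setTI.
have mf : measurable_fun setT
    (fun t => `|X t ord0 i - rat_point a.1 ord0 i| < a.2.+1%:R^-1).
  apply: measurable_fun_ltr => //; apply: measurableT_comp => //.
  exact: measurable_funB.
exact: (mf measurableT [set true]).
Qed.

End euclid_measurability.

(** * The Euclidean inner product *)

Section dot_product.
Context {R : realType} {d : nat}.
Implicit Types x y z : 'rV[R]_d.

Definition dotv x y : R := \sum_(i < d) x ord0 i * y ord0 i.

Lemma sqnormE x : sqnorm x = dotv x x.
Proof. by apply: eq_bigr => i _; rewrite expr2. Qed.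

Lemma dotvC x y : dotv x y = dotv y x.
Proof. by apply: eq_bigr => i _; rewrite mulrC. Qed.

Lemma dotvDl x y z : dotv (x + y) z = dotv x z + dotv y z.
Proof. by rewrite -big_split/=; apply: eq_bigr => i _; rewrite mxE mulrDl. Qed.

Lemma dotvZl (a : R) x z : dotv (a *: x) z = a * dotv x z.
Proof. by rewrite mulr_sumr; apply: eq_bigr => i _; rewrite mxE mulrA. Qed.

Lemma dotvDr x y z : dotv z (x + y) = dotv z x + dotv z y.
Proof. by rewrite dotvC dotvDl !(dotvC z). Qed.

Lemma dotvZr (a : R) x z : dotv z (a *: x) = a * dotv z x.
Proof. by rewrite dotvC dotvZl (dotvC z). Qed.

Lemma dotvNl x z : dotv (- x) z = - dotv x z.
Proof. by rewrite -scaleN1r dotvZl mulN1r. Qed.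

Lemma dotvBl x y z : dotv (x - y) z = dotv x z - dotv y z.
Proof. by rewrite dotvDl dotvNl. Qed.

Lemma sqnorm_ge0 x : 0 <= sqnorm x.
Proof. by apply: sumr_ge0 => i _; exact: sqr_ge0. Qed.

Lemma sqr_coord_le x i : x ord0 i ^+ 2 <= sqnorm x.
Proof.
by rewrite /sqnorm (bigD1 i)//= lerDl; apply: sumr_ge0 => j _; exact: sqr_ge0.
Qed.

Lemma normr_coord_le x i : `|x ord0 i| <= 1 + sqnorm x.
Proof.
have := sqr_coord_le x i; rewrite -real_normK ?num_real//.
by have := normr_ge0 (x ord0 i); nra.
Qed.

Lemma normr_dotv_le x y : `|dotv x y| <= sqnorm x + sqnorm y.
Proof.
apply: le_trans (ler_norm_sum _ _ _) _.
rewrite /sqnorm -big_split/=; apply: ler_sum => i _.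
rewrite ler_norml; apply/andP; split; nra.
Qed.

Lemma sqnorm0 : sqnorm (0 : 'rV[R]_d) = 0.
Proof. by rewrite /sqnorm big1// => i _; rewrite mxE expr0n. Qed.

Lemma sqnormZ (a : R) x : sqnorm (a *: x) = a ^+ 2 * sqnorm x.
Proof. by rewrite !sqnormE dotvZl dotvZr mulrA. Qed.

Lemma sqnormN x : sqnorm (- x) = sqnorm x.
Proof. by rewrite -scaleN1r sqnormZ sqrrN expr1n mul1r. Qed.

Lemma sqnormD_le x y : sqnorm (x + y) <= 2 * (sqnorm x + sqnorm y).
Proof.
rewrite /sqnorm -big_split/= mulr_sumr; apply: ler_sum => i _.
by rewrite mxE; have := sqr_ge0 (x ord0 i - y ord0 i); nra.
Qed.

End dot_product.

(** * Finite convex functions on R^d *)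

Section convex_functions.
Context {R : realType} {d : nat}.
Implicit Types (x y z : 'rV[R]_d) (phi : 'rV[R]_d -> R).

Lemma convex_functionP phi :
  convex_function [set: convex_lmodType 'rV[R]_d] phi <->
  forall (t : R) x y, 0 <= t -> t <= 1 ->
    phi (t *: x + (1 - t) *: y) <= t * phi x + (1 - t) * phi y.
Proof.
split=> [cphi t x y t0 t1|cphi t x y _ _].
  have t01 : Itv.spec (Itv.num_sem (R := R)) (Itv.Real `[0%Z, 1%Z]) t.
    by rewrite /= /Itv.num_sem num_real/= in_itv/= t0 t1.
  by have := cphi (Itv.mk t01) x y; rewrite !in_setT => /(_ isT isT).
by apply: (cphi t%:num x y).
Qed.

Variable phi : 'rV[R]_d -> R.
Hypothesis cphi : convex_function [set: convex_lmodType 'rV[R]_d] phi.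

Let cvx := (convex_functionP phi).1 cphi.

(** The coordinates are freed one at a time: a point of a box is the midpoint
    of a point of a larger box of lower dimension and a point on an axis. *)
Lemma convex_bounded_box (r : R) :
  exists M, forall x, (forall i, `|x ord0 i| <= r) -> phi x <= M.
Proof.
suff /(_ d r)[M HM] : forall (k : nat) (s : R), exists M, forall x,
    (forall i, `|x ord0 i| <= s) ->
    (forall i : 'I_d, (k <= i)%N -> x ord0 i = 0) -> phi x <= M.
  by exists M => x xr; apply: HM => // i; rewrite leqNgt ltn_ord.
elim=> [|k IH] s.
  exists (phi 0) => x _ x0; rewrite (_ : x = 0)//.
  by apply/rowP => i; rewrite mxE x0.
have [M HM] := IH (2 * s).
have [kd|dk] := ltnP k d; last first.
  exists M => x xs x0; apply: HM => i.
    by apply: le_trans (xs i) _; have := le_trans (normr_ge0 _) (xs i); lra.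
  by move=> ki; have := ltn_ord i; rewrite ltnNge (leq_trans dk ki).
pose ik := Ordinal kd; pose e : 'rV[R]_d := delta_mx ord0 ik.
exists (2^-1 * M + 2^-1 * (`|phi ((2 * s) *: e)| + `|phi (- (2 * s) *: e)|)).
move=> x xs x0.
pose u : 'rV[R]_d := 2 *: (x - x ord0 ik *: e).
pose v : 'rV[R]_d := (2 * x ord0 ik) *: e.
have -> : x = 2^-1 *: u + (1 - 2^-1) *: v.
  by apply/rowP => i; rewrite !mxE; field.
apply: le_trans (cvx _ _ _ _) _; [lra|lra|].
rewrite (_ : 1 - 2^-1 = 2^-1 :> R); last by field.
apply: lerD; rewrite ler_pM2l ?invr_gt0//.
- apply: HM => i; rewrite !mxE eqxx/=.
    have := xs i; have [->|ik'] := eqVneq i ik.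
      rewrite mulr1 subrr mulr0 normr0; have := normr_ge0 (x ord0 ik); lra.
    by rewrite mulr0 subr0 normrM (ger0_norm (_ : 0 <= 2))// ler_pM2l.
  rewrite leq_eqVlt => /orP[/eqP ki|ki].
    rewrite (_ : i = ik) ?eqxx/=; last exact/val_inj.
    by rewrite mulr1 subrr mulr0.
  rewrite x0// (_ : i == ik = false) ?mulr0 ?subr0 ?mulr0//.
  by apply/negbTE; rewrite -val_eqE/= neq_ltn ki orbT.
have := xs ik; rewrite ler_norml => /andP[x1 x2].
have [s0|s0] := ltP 0 s; last first.
  have xk0 : x ord0 ik = 0 by lra.
  rewrite /v xk0; have -> : s = 0 by lra.
  by apply: le_trans (ler_norm _) _; rewrite lerDl.
pose t := (1 + x ord0 ik / s) / 2.
have ts : t * s = (s + x ord0 ik) / 2.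
  by rewrite /t; field; rewrite gt_eqF.
have t0 : 0 <= t by rewrite -(pmulr_lge0 _ s0) ts; lra.
have t1 : t <= 1 by rewrite -(ler_pM2r s0) ts mul1r; lra.
have -> : v = t *: ((2 * s) *: e) + (1 - t) *: (- (2 * s) *: e).
  rewrite /v !scalerA -scalerDl; congr (_ *: _).
  by rewrite mulrN mulrBl mul1r opprB [t * _]mulrCA ts; field.
apply: le_trans (cvx _ _ t0 t1) _.
apply: lerD.
  rewrite -[leRHS]mul1r; apply: le_trans (ler_wpM2l t0 (ler_norm _)) _.
  exact: ler_wpM2r.
rewrite -[leRHS]mul1r.
have t1' : 0 <= 1 - t by lra.
apply: le_trans (ler_wpM2l t1' (ler_norm _)) _.
by apply: ler_wpM2r => //; lra.
Qed.

(** The point -x / (1 + |x|^2) stays in the unit box, where phi is bounded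
    above, and 0 lies between it and x. *)
Lemma convex_lower_bound : exists C, 0 <= C /\
  forall x, - (C * (1 + sqnorm x)) <= phi x.
Proof.
have [M HM] := convex_bounded_box 1.
exists (2 * (`|phi 0| + `|M|)); split.
  by rewrite mulr_ge0// addr_ge0.
move=> x; set q := sqnorm x; have q0 : 0 <= q := sqnorm_ge0 x.
pose s := 1 + q; have s0 : 0 < s by rewrite /s; lra.
have HMx : phi (- s^-1 *: x) <= M.
  apply: HM => i; rewrite mxE normrM normrN normfV (gtr0_norm s0) mulrC.
  rewrite ler_pdivrMr// mul1r.
  exact: normr_coord_le.
have := cvx (t := (1 + s)^-1) x (- s^-1 *: x).
have -> : (1 + s)^-1 *: x + (1 - (1 + s)^-1) *: (- s^-1 *: x) = 0.
  rewrite scalerA -scalerDl (_ : _ + _ = 0) ?scale0r//.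
  by field; rewrite !gt_eqF//; lra.
have s1 : 0 < 1 + s by lra.
rewrite invr_ge0 (ltW s1) => /(_ isT).
rewrite invf_le1//; have -> : 1 <= 1 + s by lra.
move=> /(_ isT); rewrite -(ler_pM2l s1).
have -> : (1 + s) * ((1 + s)^-1 * phi x + (1 - (1 + s)^-1) * phi (- s^-1 *: x)) =
    phi x + s * phi (- s^-1 *: x) by field; rewrite gt_eqF.
move=> H.
have := ler_norm M; have := ler_norm (- phi 0); rewrite normrN => h1 h2.
have := ler_wpM2l (ltW s0) HMx => h3.
have h4 := ler_wpM2l (ltW s0) h2.
have h5 := ler_wpM2l (ltW s1) h1.
have := normr_ge0 M; have := normr_ge0 (phi 0); rewrite /s in H h3 h4 h5 *.
nra.
Qed.

Lemma convex_continuous : continuous phi.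
Proof.
move=> x.
suff H : forall e, 0 < e -> exists2 s, 0 < s &
    forall y, ball x s y -> `|phi x - phi y| < e.
  apply/cvgrPdist_lt => [|e /H[s s0 sP]]; first exact: nbhs_filter.
  exact: (filterS sP (nbhsx_ballx x s s0)).
move=> e e0.
have [M HM] := convex_bounded_box ((1 + sqnorm x) + 1).
have HM' y : (forall i, `|y ord0 i| <= 1) -> phi (x + y) <= M.
  move=> y1; apply: HM => i; rewrite mxE (le_trans (ler_normD _ _))// lerD//.
  exact: normr_coord_le.
have K0 : 0 <= M - phi x.
  have := HM' 0; rewrite addr0 subr_ge0; apply => i.
  by rewrite mxE normr0.
pose s := Num.min 1 (e / (M - phi x + 1)).
have K1 : 0 < M - phi x + 1 by lra.
have s0 : 0 < s by rewrite lt_min ltr01 divr_gt0.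
have s1 : s <= 1 by rewrite ge_min lexx.
have se : s * (M - phi x) < e.
  have : s * (M - phi x + 1) <= e.
    by rewrite -ler_pdivlMr// ge_min lexx orbT.
  by rewrite mulrDr mulr1; lra.
exists s => // y xy.
pose h := y - x.
have hs i : `|(s^-1 *: h) ord0 i| <= 1.
  rewrite !mxE normrM normfV (gtr0_norm s0) mulrC ler_pdivrMr// mul1r.
  by rewrite distrC; case: xy => _ /(_ ord0 i)/ltW.
have h1 := HM' _ hs.
have h2 : phi (x - s^-1 *: h) <= M.
  by apply: HM' => i; rewrite mxE normrN; exact: hs.
have yE : y = s *: (x + s^-1 *: h) + (1 - s) *: x.
  rewrite scalerDr scalerA divff ?gt_eqF// scale1r scalerBl scale1r /h.
  by rewrite addrC addrA subrK addrC subrK.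
have xE : x = (1 + s)^-1 *: y + (1 - (1 + s)^-1) *: (x - s^-1 *: h).
  apply/rowP => i; rewrite !mxE; field.
  by rewrite !gt_eqF//; lra.
have s1p : 0 < 1 + s by lra.
have h3 : phi y <= s * phi (x + s^-1 *: h) + (1 - s) * phi x.
  by rewrite [in leLHS]yE; apply: cvx => //; exact: ltW.
have h4 : (1 + s) * phi x <= phi y + s * phi (x - s^-1 *: h).
  rewrite -(ler_pM2l (_ : 0 < (1 + s)^-1)) ?invr_gt0//.
  rewrite mulKf ?gt_eqF// [in leLHS]xE.
  apply: le_trans (cvx _ _ _ _) _.
  - by rewrite invr_ge0 ltW.
  - by rewrite invf_le1//; lra.
  rewrite le_eqVlt; apply/orP; left; apply/eqP.
  by field; rewrite gt_eqF.
have h5 := ler_wpM2l (ltW s0) h1; have h6 := ler_wpM2l (ltW s0) h2.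
rewrite ltr_norml; apply/andP; split; lra.
Qed.

Lemma convex_measurable : measurable_fun setT (phi : euclid R d -> R).
Proof. by apply: continuous_measurable_euclid; exact: convex_continuous. Qed.

End convex_functions.

(** * Square-integrable random vectors *)

Section square_integrable.
Context {R : realType} {d : nat} {dT} {T : measurableType dT}.
Variable P : probability T R.
Implicit Types X Y Z : T -> 'rV[R]_d.

Definition square_integrable X :=
  measurable_fun setT (X : T -> euclid R d) /\
  P.-integrable setT (EFin \o (fun t => sqnorm (X t))).

Definition inner X Y : R := \int[P]_t dotv (X t) (Y t).

Definition norm2 X : R := Num.sqrt (inner X X).

Lemma measurable_rv_coord X (i : 'I_d) :
  measurable_fun setT (X : T -> euclid R d) ->
  measurable_fun setT (fun t => X t ord0 i).
Proof. by move=> mX; apply: (measurableT_comp (measurable_coord i) mX). Qed.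

Lemma measurable_dotv X Y :
  measurable_fun setT (X : T -> euclid R d) ->
  measurable_fun setT (Y : T -> euclid R d) ->
  measurable_fun setT (fun t => dotv (X t) (Y t)).
Proof.
move=> mX mY; apply: measurable_sum => i.
by apply: measurable_funM; exact: measurable_rv_coord.
Qed.

Lemma measurable_sqnorm X : measurable_fun setT (X : T -> euclid R d) ->
  measurable_fun setT (fun t => sqnorm (X t)).
Proof.
move=> mX; under eq_fun do rewrite sqnormE; exact: measurable_dotv.
Qed.

Lemma measurable_rvD X Y :
  measurable_fun setT (X : T -> euclid R d) ->
  measurable_fun setT (Y : T -> euclid R d) ->
  measurable_fun setT ((fun t => X t + Y t) : T -> euclid R d).
Proof.
move=> mX mY; apply: measurable_to_euclid => i.
under eq_fun do rewrite mxE.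
by apply: measurable_funD; exact: measurable_rv_coord.
Qed.

Lemma measurable_rvZ (a : R) X :
  measurable_fun setT (X : T -> euclid R d) ->
  measurable_fun setT ((fun t => a *: X t) : T -> euclid R d).
Proof.
move=> mX; apply: measurable_to_euclid => i.
under eq_fun do rewrite mxE.
by apply: measurable_funM => //; exact: measurable_rv_coord.
Qed.

Lemma measurable_rvB X Y :
  measurable_fun setT (X : T -> euclid R d) ->
  measurable_fun setT (Y : T -> euclid R d) ->
  measurable_fun setT ((fun t => X t - Y t) : T -> euclid R d).
Proof.
move=> mX mY; apply: measurable_rvD => //.
by under eq_fun do rewrite -scaleN1r; exact: measurable_rvZ.
Qed.

Lemma integrable_dominated (f g : T -> R) : measurable_fun setT f ->
  (forall t, `|f t| <= g t) -> P.-integrable setT (EFin \o g) ->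
  P.-integrable setT (EFin \o f).
Proof.
move=> mf fg; apply: le_integrable => //; first exact/measurable_EFinP.
move=> t _ /=; rewrite lee_fin (le_trans (fg t))// ler_norm//.
Qed.

Lemma square_integrableD X Y : square_integrable X -> square_integrable Y ->
  square_integrable (fun t => X t + Y t).
Proof.
move=> [mX iX] [mY iY]; split; first exact: measurable_rvD.
have := integrableZl measurableT 2 (integrableD measurableT iX iY).
apply: integrable_dominated => [|t].
  exact/measurable_sqnorm/measurable_rvD.
by rewrite ger0_norm ?sqnorm_ge0//; exact: sqnormD_le.
Qed.

Lemma square_integrableZ (a : R) X : square_integrable X ->
  square_integrable (fun t => a *: X t).
Proof.
move=> [mX iX]; split; first exact: measurable_rvZ.
have := integrableZl measurableT (a ^+ 2) iX.
apply: integrable_dominated => [|t]; first exact/measurable_sqnorm/measurable_rvZ.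
by rewrite ger0_norm ?sqnorm_ge0// sqnormZ.
Qed.

Lemma square_integrableB X Y : square_integrable X -> square_integrable Y ->
  square_integrable (fun t => X t - Y t).
Proof.
move=> sX sY; apply: square_integrableD => //.
by under eq_fun do rewrite -scaleN1r; exact: square_integrableZ.
Qed.

Lemma integrable_dotv X Y : square_integrable X -> square_integrable Y ->
  P.-integrable setT (EFin \o (fun t => dotv (X t) (Y t))).
Proof.
move=> [mX iX] [mY iY]; have := integrableD measurableT iX iY.
apply: integrable_dominated => [|t]; first exact: measurable_dotv.
exact: normr_dotv_le.
Qed.

Lemma innerC X Y : inner X Y = inner Y X.
Proof. by apply: eq_Rintegral => t _; rewrite dotvC. Qed.

Lemma innerDl X Y Z : square_integrable X -> square_integrable Y ->
  square_integrable Z ->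
  inner (fun t => X t + Y t) Z = inner X Z + inner Y Z.
Proof.
move=> sX sY sZ; rewrite /inner; under eq_Rintegral do rewrite dotvDl.
by rewrite RintegralD//; exact: integrable_dotv.
Qed.

Lemma innerZl (a : R) X Z : square_integrable X -> square_integrable Z ->
  inner (fun t => a *: X t) Z = a * inner X Z.
Proof.
move=> sX sZ; rewrite /inner; under eq_Rintegral do rewrite dotvZl.
by rewrite RintegralZl//; exact: integrable_dotv.
Qed.

Lemma innerBl X Y Z : square_integrable X -> square_integrable Y ->
  square_integrable Z ->
  inner (fun t => X t - Y t) Z = inner X Z - inner Y Z.
Proof.
move=> sX sY sZ; rewrite /inner; under eq_Rintegral do rewrite dotvBl.
by rewrite RintegralB//; exact: integrable_dotv.
Qed.

Lemma innerBr X Y Z : square_integrable X -> square_integrable Y ->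
  square_integrable Z ->
  inner Z (fun t => X t - Y t) = inner Z X - inner Z Y.
Proof. by move=> sX sY sZ; rewrite innerC innerBl// !(innerC _ Z). Qed.

Lemma inner_ge0 X : 0 <= inner X X.
Proof. by apply: Rintegral_ge0 => t _; rewrite -sqnormE sqnorm_ge0. Qed.

Lemma norm2_ge0 X : 0 <= norm2 X.
Proof. exact: sqrtr_ge0. Qed.

Lemma sqr_norm2 X : norm2 X ^+ 2 = inner X X.
Proof. by rewrite sqr_sqrtr// inner_ge0. Qed.

Lemma norm2_le X (a : R) : 0 <= a -> inner X X <= a ^+ 2 -> norm2 X <= a.
Proof.
by move=> a0 Xa; rewrite -(ger0_norm a0) -sqrtr_sqr ler_sqrt ?sqr_ge0.
Qed.

Lemma norm2BC X Y : norm2 (fun t => X t - Y t) = norm2 (fun t => Y t - X t).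
Proof.
congr Num.sqrt; apply: eq_Rintegral => t _.
by rewrite -opprB -!sqnormE sqnormN.
Qed.

Lemma inner_subZ (a : R) X Y : square_integrable X -> square_integrable Y ->
  inner (fun t => X t - a *: Y t) (fun t => X t - a *: Y t) =
    inner X X - 2 * a * inner X Y + a ^+ 2 * inner Y Y.
Proof.
move=> sX sY; have sZ := square_integrableZ a sY.
have sB := square_integrableB sX sZ.
rewrite innerBl ?innerBr// (innerC X (fun t => _ *: _)) !innerZl//.
by rewrite (innerC Y (fun t => _ *: _)) innerZl// (innerC Y X); ring.
Qed.

Lemma cauchy_schwarz X Y : square_integrable X -> square_integrable Y ->
  inner X Y <= norm2 X * norm2 Y.
Proof.
move=> sX sY.
(* the quadratic polynomial of t whose discriminant gives the inequality *)
have H t : 0 <= inner X X - 2 * t * inner X Y + t ^+ 2 * inner Y Y.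
  by rewrite -inner_subZ//; exact: inner_ge0.
have [Y0|Y0] := eqVneq (inner Y Y) 0.
  rewrite leNgt; apply/negP => h.
  have XY : 0 < inner X Y.
    by apply: le_lt_trans h; rewrite mulr_ge0// norm2_ge0.
  have := H ((inner X X + 1) / (2 * inner X Y)).
  rewrite Y0 mulr0 addr0 -mulrA [X in 2 * X](_ : _ = (inner X X + 1) / 2).
    by have := inner_ge0 X; lra.
  by field; rewrite gt_eqF.
have Yp : 0 < inner Y Y by rewrite lt_neqAle eq_sym Y0 inner_ge0.
have := H (inner X Y / inner Y Y).
have -> : inner X X - 2 * (inner X Y / inner Y Y) * inner X Y +
   (inner X Y / inner Y Y) ^+ 2 * inner Y Y =
   inner X X - inner X Y ^+ 2 / inner Y Y by field.
rewrite subr_ge0 ler_pdivrMr// -!sqr_norm2 -exprMn => h.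
apply: le_trans (ler_norm _) _.
by rewrite -ler_sqr ?nnegrE ?mulr_ge0 ?norm2_ge0// real_normK ?num_real.
Qed.

Lemma norm2D X Y : square_integrable X -> square_integrable Y ->
  norm2 (fun t => X t + Y t) <= norm2 X + norm2 Y.
Proof.
move=> sX sY; have sXY := square_integrableD sX sY.
apply: norm2_le; first by rewrite addr_ge0// norm2_ge0.
rewrite innerDl// !(innerC _ (fun t => X t + Y t)) !innerDl//.
have := cauchy_schwarz sX sY; rewrite (innerC Y X).
by rewrite sqrrD !sqr_norm2; lra.
Qed.

Lemma norm2B X Y :
  square_integrable X -> square_integrable Y ->
  norm2 (fun t => X t - Y t) <= norm2 X + norm2 Y.
Proof.
move=> sX sY; have -> : norm2 Y = norm2 (fun t => - Y t).
  by congr Num.sqrt; apply: eq_Rintegral => t _; rewrite -!sqnormE sqnormN.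
apply: norm2D => //.
by under eq_fun do rewrite -scaleN1r; exact: square_integrableZ.
Qed.

(** The telescoping of Z - Z' through X and X' behind the stability estimate. *)
Lemma sqr_norm2_split Z X X' Z' :
  square_integrable Z -> square_integrable X ->
  square_integrable X' -> square_integrable Z' ->
  norm2 (fun t => Z t - Z' t) ^+ 2 =
    inner (fun t => X t - Z t) (fun t => Z' t - Z t) +
    inner (fun t => X t - X' t) (fun t => Z t - Z' t) +
    inner (fun t => X' t - Z' t) (fun t => Z t - Z' t).
Proof.
move=> sZ sX sX' sZ'.
have sXX' := square_integrableB sX sX'; have sZZ' := square_integrableB sZ sZ'.
have sXZ := square_integrableB sX sZ; have sXZ' := square_integrableB sX' sZ'.
by rewrite sqr_norm2 !innerBr// !innerBl//; ring.
Qed.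

Lemma norm2_dist Y X Z : square_integrable X -> square_integrable Y ->
  square_integrable Z ->
  norm2 (fun t => X t - Z t) <=
    norm2 (fun t => X t - Y t) + norm2 (fun t => Y t - Z t).
Proof.
move=> sX sY sZ.
have -> : (fun t => X t - Z t) = (fun t => (X t - Y t) + (Y t - Z t)).
  by apply/funext => t; rewrite addrA subrK.
by apply: norm2D; exact: square_integrableB.
Qed.

End square_integrable.

(** * Laws and the convex order *)

Section laws.
Context {R : realType} {dT} {T : measurableType dT} (P : probability T R).
Context {dS} {S : measurableType dS}.

Definition has_law (X : T -> S) (alpha : probability S R) :=
  measurable_fun setT X /\
  forall A, measurable A -> P (X @^-1` A) = alpha A.

Lemma has_law_distribution (X : T -> S) : measurable_fun setT X ->
  exists alpha, has_law X alpha.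
Proof.
move=> mX; pose mX' := isMeasurableFun.Build _ _ _ _ _ mX.
pose X' : {mfun T >-> S} := HB.pack X mX'.
by exists (distribution P X'); split.
Qed.

Section transfer.
Variables (X : T -> S) (alpha : probability S R).
Hypothesis lX : has_law X alpha.

Lemma law_ge0_integral (g : S -> \bar R) : measurable_fun setT g ->
  (forall y, 0 <= g y)%E -> (\int[alpha]_y g y = \int[P]_t g (X t))%E.
Proof.
move=> mg g0; have [mX lXE] := lX.
transitivity (\int[pushforward P X]_y g y)%E.
  by apply: eq_measure_integral => A mA _; exact/esym/lXE.
by rewrite ge0_integral_pushforward.
Qed.

Lemma law_integral (g : S -> \bar R) : measurable_fun setT g ->
  (\int[alpha]_y g y = \int[P]_t g (X t))%E.
Proof.
move=> mg; rewrite integralE [in RHS]integralE.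
rewrite law_ge0_integral//; last exact: measurable_funepos.
rewrite law_ge0_integral//; last exact: measurable_funeneg.
by congr (_ - _)%E; apply: eq_integral => t _; rewrite ?funeposE ?funenegE.
Qed.

Lemma law_Rintegral (g : S -> R) : measurable_fun setT g ->
  \int[alpha]_y g y = \int[P]_t g (X t).
Proof.
by move=> mg; rewrite /Rintegral law_integral//; exact/measurable_EFinP.
Qed.

Lemma law_integrable (g : S -> R) : alpha.-integrable setT (EFin \o g) ->
  P.-integrable setT (EFin \o (fun t => g (X t))).
Proof.
have [mX _] := lX.
move=> /integrableP[mg ig]; apply/integrableP; split.
  exact: (measurableT_comp mg mX).
by move: ig; rewrite law_ge0_integral//; exact: measurableT_comp.
Qed.

End transfer.
End laws.

Section law_composition.
Context {R : realType} {dT} {T : measurableType dT} (P : probability T R).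
Context {dS} {S : measurableType dS} (alpha : probability S R).
Context {dU} {U : measurableType dU} (beta : probability U R).

Lemma has_law_comp (X : T -> S) (f : S -> U) :
  has_law P X alpha -> has_law alpha f beta ->
  has_law P (fun t => f (X t)) beta.
Proof.
move=> [mX lX] [mf lf]; split; first exact: (measurableT_comp mf mX).
move=> A mA; rewrite -lf// -lX// -[X in measurable X]setTI.
exact: mf.
Qed.

End law_composition.

Section law_L2.
Context {R : realType} {d : nat} {dT} {T : measurableType dT}.
Context {dS} {S : measurableType dS}.
Variables (P : probability T R) (Q : probability S R) (pr : T -> S).
Hypothesis lpr : has_law P pr Q.
Implicit Types X Y : S -> 'rV[R]_d.

Lemma square_integrable_comp X : square_integrable Q X ->
  square_integrable P (fun t => X (pr t)).
Proof.
move=> [mX iX]; split; first by apply: (measurableT_comp mX lpr.1).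
by have := law_integrable lpr iX.
Qed.

Lemma inner_comp X Y :
  measurable_fun setT (X : S -> euclid R d) ->
  measurable_fun setT (Y : S -> euclid R d) ->
  inner P (fun t => X (pr t)) (fun t => Y (pr t)) = inner Q X Y.
Proof.
by move=> mX mY; rewrite /inner (law_Rintegral lpr)//; exact: measurable_dotv.
Qed.

Lemma norm2_comp X : measurable_fun setT (X : S -> euclid R d) ->
  norm2 P (fun t => X (pr t)) = norm2 Q X.
Proof. by move=> mX; rewrite /norm2 inner_comp. Qed.

End law_L2.

Section euclid_laws.
Context {R : realType} {d : nat}.
Implicit Types alpha beta nu rho : probability (euclid R d) R.

Lemma measurable_euclid_id :
  measurable_fun setT ((fun x : euclid R d => (x : 'rV[R]_d)) :
    euclid R d -> euclid R d).
Proof. exact: measurable_id. Qed.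

Lemma P2_square_integrable alpha : P2 alpha ->
  square_integrable alpha (fun x : euclid R d => (x : 'rV[R]_d)).
Proof.
move=> h; split; first exact: measurable_id.
have msq := measurable_sqnorm measurable_euclid_id.
apply/integrableP; split; first exact/measurable_EFinP.
rewrite (_ : (fun x => _) =
    (fun x : euclid R d => (sqnorm (x : 'rV[R]_d))%:E))//.
by apply/funext => x /=; rewrite ger0_norm// sqnorm_ge0.
Qed.

Context {dT} {T : measurableType dT} (P : probability T R).
Implicit Types X Y Z : T -> 'rV[R]_d.

Lemma law_square_integrable X alpha :
  has_law P (X : T -> euclid R d) alpha -> P2 alpha -> square_integrable P X.
Proof. by move=> lX /P2_square_integrable/(square_integrable_comp lX). Qed.

Lemma law_P2 X alpha :
  has_law P (X : T -> euclid R d) alpha -> square_integrable P X -> P2 alpha.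
Proof.
move=> lX [mX /integrableP[_]]; rewrite /P2/=.
rewrite (law_ge0_integral lX); last by move=> x; rewrite lee_fin sqnorm_ge0.
  by under eq_integral do rewrite /= ger0_norm ?sqnorm_ge0//.
by apply/measurable_EFinP; exact: (measurable_sqnorm measurable_euclid_id).
Qed.

(** An integral that is not +oo, of a function with integrable lower bound, is
    finite: this covers convex test functions, which are bounded below by a
    quadratic function. *)
Lemma integrable_lower_bound (f h : T -> R) : measurable_fun setT f ->
  (forall t, - h t <= f t) -> (forall t, 0 <= h t) ->
  P.-integrable setT (EFin \o h) -> (\int[P]_t (f t)%:E < +oo)%E ->
  P.-integrable setT (EFin \o f).
Proof.
move=> mf fh h0 ih fy.
have mEf : measurable_fun setT (EFin \o f) by exact/measurable_EFinP.
have mEh : measurable_fun setT (EFin \o h) by exact: measurable_int ih.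
have hy : (\int[P]_t (h t)%:E < +oo)%E.
  have /integrableP[_] := ih.
  by under eq_integral do rewrite /= ger0_norm//.
have fneg : (\int[P]_t ((EFin \o f)^\- t) < +oo)%E.
  apply: le_lt_trans hy; apply: ge0_le_integral => //.
  - exact: measurable_funeneg.
  - move=> t _; rewrite funenegE/= ge_max !lee_fin h0 andbT.
    by rewrite lerNl.
have fneg0 : (0 <= \int[P]_t ((EFin \o f)^\- t))%E by exact: integral_ge0.
have fpos : (\int[P]_t ((EFin \o f)^\+ t) < +oo)%E.
  rewrite ltey; apply/eqP => fpy.
  move: fy; rewrite integralE [X in (X - _)%E]fpy.
  by move: fneg fneg0; case: (\int[P]_t _)%E => //.
apply/integrableP; split => //.
rewrite -[fun x => _]/(abse \o (EFin \o f)) fune_abse ge0_integralD//.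
- exact: lte_add_pinfty.
- exact: measurable_funepos.
- exact: measurable_funeneg.
Qed.

(** Convexity of the test functions makes the set of measures below nu convex
    along every coupling, not only along optimal ones. *)
Lemma convex_order_interpolation X Z nu rho sigma (t : R) :
  0 <= t -> t <= 1 -> P2 nu -> P2 rho -> convex_order rho nu ->
  has_law P (X : T -> euclid R d) nu -> has_law P (Z : T -> euclid R d) rho ->
  has_law P ((fun w => t *: X w + (1 - t) *: Z w) : T -> euclid R d) sigma ->
  P2 sigma /\ convex_order sigma nu.
Proof.
move=> t0 t1 Pnu Prho rhonu lX lZ lS.
have sX := law_square_integrable lX Pnu.
have sZ := law_square_integrable lZ Prho.
split.
  apply: law_P2 lS _.
  by apply: square_integrableD; exact: square_integrableZ.
move=> phi cphi; have mphi := convex_measurable cphi.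
have mEphi : measurable_fun setT (fun x : euclid R d => (phi x)%:E).
  exact/measurable_EFinP.
have [nuy|nuNy] := eqVneq (\int[nu]_x (phi x)%:E)%E +oo%E.
  by rewrite nuy leey.
have {}nuNy : (\int[nu]_x (phi x)%:E < +oo)%E by rewrite ltey.
have [C [C0 phiC]] := convex_lower_bound cphi.
have int_phi (Y : T -> 'rV[R]_d) alpha : P2 alpha ->
    has_law P (Y : T -> euclid R d) alpha ->
    (\int[alpha]_x (phi x)%:E < +oo)%E ->
    P.-integrable setT (EFin \o (fun w => phi (Y w))).
  move=> Pal lY aly; have [mY iY] := law_square_integrable lY Pal.
  apply: (integrable_lower_bound (h := fun w => C * (1 + sqnorm (Y w)))).
  - exact: (measurableT_comp mphi mY).
  - by move=> w; exact: phiC.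
  - by move=> w; rewrite mulr_ge0// addr_ge0// sqnorm_ge0.
  - apply: (integrableZl measurableT C
      (f := fun w => (1%:E + (sqnorm (Y w))%:E)%E)).
    apply: integrableD => //.
    exact: finite_measure_integrable_cst.
  - by move: aly; rewrite (law_integral lY).
have iX := int_phi X nu Pnu lX nuNy.
have iZ := int_phi Z rho Prho lZ (le_lt_trans (rhonu _ cphi) nuNy).
have mS := lS.1.
rewrite (law_integral lS)//.
apply: (@le_trans _ _ (\int[P]_w (t * phi (X w) + (1 - t) * phi (Z w))%:E)%E).
  have iXZ : P.-integrable setT
      (EFin \o (fun w => t * phi (X w) + (1 - t) * phi (Z w))).
    exact: (integrableD measurableT (integrableZl measurableT t iX)
      (integrableZl measurableT (1 - t) iZ)).
  have conv_le w : phi (t *: X w + (1 - t) *: Z w) <=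
      t * phi (X w) + (1 - t) * phi (Z w).
    exact: (convex_functionP phi).1.
  apply: le_integral => //; last by move=> w _; rewrite lee_fin.
  pose h w := C * (1 + sqnorm (t *: X w + (1 - t) *: Z w)).
  have [_ iS] : square_integrable P (fun w => t *: X w + (1 - t) *: Z w).
    by apply: square_integrableD; exact: square_integrableZ.
  have ih : P.-integrable setT (EFin \o h).
    apply: (integrableZl measurableT C (f := fun w =>
      (1%:E + (sqnorm (t *: X w + (1 - t) *: Z w))%:E)%E)).
    apply: integrableD => //.
    exact: finite_measure_integrable_cst.
  have := integrableD measurableT ih (integrable_abse iXZ).
  apply: integrable_dominated.
    exact: (measurableT_comp mphi mS).
  move=> w; rewrite ler_norml.
  have h0 : 0 <= h w by rewrite mulr_ge0// addr_ge0// sqnorm_ge0.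
  have := phiC (t *: X w + (1 - t) *: Z w); rewrite -/(h w) => h1.
  have := conv_le w; have := ler_norm (t * phi (X w) + (1 - t) * phi (Z w)).
  have := normr_ge0 (t * phi (X w) + (1 - t) * phi (Z w)).
  by move=> *; apply/andP; split; lra.
under eq_integral do rewrite EFinD !EFinM.
rewrite integralD//; last 2 first.
- exact: (integrableZl measurableT t iX).
- exact: (integrableZl measurableT (1 - t) iZ).
rewrite (integralZl measurableT iX) (integralZl measurableT iZ).
rewrite -(law_integral lX mEphi) -(law_integral lZ mEphi).
have nufin : (\int[nu]_x (phi x)%:E)%E \is a fin_num.
  by rewrite (law_integral lX mEphi); exact: integrable_fin_num.
apply: (@le_trans _ _
  (t%:E * \int[nu]_x (phi x)%:E + (1 - t)%:E * \int[nu]_x (phi x)%:E)%E).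
  by rewrite leeD2l// lee_wpmul2l ?lee_fin ?subr_ge0//; exact: rhonu.
rewrite -ge0_muleDl ?lee_fin ?subr_ge0//.
by rewrite -EFinD addrC subrK mul1e.
Qed.

End euclid_laws.

(** * The Wasserstein distance through random vectors *)

Section wasserstein.
Context {R : realType} {d : nat}.
Local Notation E := (euclid R d).
Implicit Types alpha beta : probability E R.

Definition proj1v (z : E * E) : 'rV[R]_d := z.1.
Definition proj2v (z : E * E) : 'rV[R]_d := z.2.

Definition W2_real alpha beta : R := Num.sqrt (fine (W2sq alpha beta)).

Lemma coupling_fst (pi : probability (E * E)%type R) alpha beta :
  couplings alpha beta pi -> has_law pi (proj1v : E * E -> E) alpha.
Proof. by move=> h; split; [exact: measurable_fst|move=> A /h[]]. Qed.

Lemma coupling_snd (pi : probability (E * E)%type R) alpha beta :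
  couplings alpha beta pi -> has_law pi (proj2v : E * E -> E) beta.
Proof. by move=> h; split; [exact: measurable_snd|move=> A /h[]]. Qed.

Lemma measurable_proj1v : measurable_fun setT (proj1v : E * E -> E).
Proof. exact: measurable_fst. Qed.

Lemma measurable_proj2v : measurable_fun setT (proj2v : E * E -> E).
Proof. exact: measurable_snd. Qed.

Lemma inner_cost {dT} {T : measurableType dT} (P : probability T R)
    (Z : T -> 'rV[R]_d) : square_integrable P Z ->
  (\int[P]_t (sqnorm (Z t))%:E)%E = (inner P Z Z)%:E.
Proof.
move=> [mZ iZ]; have -> : inner P Z Z = \int[P]_t sqnorm (Z t).
  by apply: eq_Rintegral => t _; rewrite sqnormE.
by rewrite /Rintegral fineK//; exact: integrable_fin_num.
Qed.

Lemma W2sq_ge0 alpha beta : (0 <= W2sq alpha beta)%E.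
Proof.
apply: le_ereal_inf_tmp => _ [pi _ <-].
by apply: integral_ge0 => z _; rewrite lee_fin sqnorm_ge0.
Qed.

Lemma W2sq_le {dT} {T : measurableType dT} (P : probability T R)
    (X Y : T -> 'rV[R]_d) alpha beta : P2 alpha -> P2 beta ->
  has_law P (X : T -> E) alpha -> has_law P (Y : T -> E) beta ->
  (W2sq alpha beta <= (inner P (fun t => X t - Y t) (fun t => X t - Y t))%:E)%E.
Proof.
move=> Pa Pb lX lY.
have mXY : measurable_fun setT (fun t => (X t, Y t) : E * E).
  by apply: measurable_fun_pair; [exact: lX.1|exact: lY.1].
have [pi lpi] := has_law_distribution P mXY.
have pic : couplings alpha beta pi.
  move=> A mA; rewrite /pushforward -!lpi.2.
  - by split; [exact: lX.2|exact: lY.2].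
  - by rewrite -[X in measurable X]setTI; exact: measurable_snd.
  - by rewrite -[X in measurable X]setTI; exact: measurable_fst.
apply: ereal_inf_lbound; exists pi => //.
have sX := law_square_integrable lX Pa; have sY := law_square_integrable lY Pb.
rewrite -inner_cost; last exact: square_integrableB.
rewrite /transport_cost (law_integral lpi)//.
apply/measurable_EFinP; apply: measurable_sqnorm.
by apply: measurable_rvB; [exact: measurable_proj1v|exact: measurable_proj2v].
Qed.

Lemma W2sq_fin_num alpha beta : P2 alpha -> P2 beta ->
  W2sq alpha beta \is a fin_num.
Proof.
move=> Pa Pb; rewrite ge0_fin_numE ?W2sq_ge0//.
pose P : probability (E * E)%type R := (alpha \x beta)%E.
have l1 : has_law P (proj1v : E * E -> E) alpha.
  split; first exact: measurable_fst.
  move=> A mA; rewrite (_ : _ @^-1` A = A `*` setT); last first.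
    by apply/seteqP; split=> [z ?|z []].
  rewrite [LHS](product_measure1E alpha beta)// -[RHS]mule1.
  by congr (_ * _)%E; exact: probability_setT.
have l2 : has_law P (proj2v : E * E -> E) beta.
  split; first exact: measurable_snd.
  move=> A mA; rewrite (_ : _ @^-1` A = setT `*` A); last first.
    by apply/seteqP; split=> [z ?|z []].
  rewrite [LHS](product_measure1E alpha beta)// -[RHS]mul1e.
  by congr (_ * _)%E; exact: probability_setT.
by apply: le_lt_trans (W2sq_le Pa Pb l1 l2) _; rewrite ltry.
Qed.

Lemma W2sqE alpha beta : P2 alpha -> P2 beta ->
  W2sq alpha beta = (W2_real alpha beta ^+ 2)%:E.
Proof.
move=> Pa Pb; rewrite sqr_sqrtr ?fineK ?W2sq_fin_num//.
by rewrite fine_ge0// W2sq_ge0.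
Qed.

Lemma W2E alpha beta : P2 alpha -> P2 beta ->
  W2 alpha beta = (W2_real alpha beta)%:E.
Proof. by move=> Pa Pb; rewrite /W2 -[in LHS](fineK (W2sq_fin_num Pa Pb)). Qed.

Lemma W2_real_ge0 alpha beta : 0 <= W2_real alpha beta.
Proof. exact: sqrtr_ge0. Qed.

Lemma sqr_W2_real_le {dT} {T : measurableType dT} (P : probability T R)
    (X Y : T -> 'rV[R]_d) alpha beta : P2 alpha -> P2 beta ->
  has_law P (X : T -> E) alpha -> has_law P (Y : T -> E) beta ->
  W2_real alpha beta ^+ 2 <= inner P (fun t => X t - Y t) (fun t => X t - Y t).
Proof.
move=> Pa Pb lX lY; rewrite -lee_fin -W2sqE//; exact: W2sq_le.
Qed.

Lemma W2_real_le {dT} {T : measurableType dT} (P : probability T R)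
    (X Y : T -> 'rV[R]_d) alpha beta : P2 alpha -> P2 beta ->
  has_law P (X : T -> E) alpha -> has_law P (Y : T -> E) beta ->
  W2_real alpha beta <= norm2 P (fun t => X t - Y t).
Proof.
move=> Pa Pb lX lY.
by rewrite -ler_sqr ?nnegrE ?W2_real_ge0 ?norm2_ge0// sqr_norm2 sqr_W2_real_le.
Qed.

(** Approximation of the infimum, whose finiteness is witnessed by the product
    coupling; attainment is never used. *)
Lemma near_optimal_coupling alpha beta (eta : R) : P2 alpha -> P2 beta ->
  0 < eta -> exists pi : probability (E * E)%type R,
  [/\ has_law pi (proj1v : E * E -> E) alpha,
      has_law pi (proj2v : E * E -> E) beta &
      norm2 pi (fun z => proj1v z - proj2v z) ^+ 2
        <= W2_real alpha beta ^+ 2 + eta].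
Proof.
move=> Pa Pb eta0.
have [_ [pi pic <-] pi_lt] := lb_ereal_inf_adherent eta0 (W2sq_fin_num Pa Pb).
have l1 := coupling_fst pic; have l2 := coupling_snd pic.
exists pi; split => //.
move: pi_lt; rewrite -/(W2sq _ _) W2sqE// /transport_cost.
rewrite (_ : integral _ _ _ = (inner pi (fun z => proj1v z - proj2v z)
    (fun z => proj1v z - proj2v z))%:E).
  by rewrite sqr_norm2 -EFinD lte_fin => /ltW.
rewrite -inner_cost//.
apply: square_integrableB; first exact: law_square_integrable l1 Pa.
exact: law_square_integrable l2 Pb.
Qed.

Lemma sqrt_excess (a D eta : R) : 0 <= D -> 0 < eta ->
  a ^+ 2 <= D ^+ 2 + eta ^+ 2 -> a <= D + eta.
Proof. by move=> D0 e0 h; rewrite leNgt; apply/negP => h'; nra. Qed.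

Lemma near_optimal_norm alpha beta (eta : R) : P2 alpha -> P2 beta ->
  0 < eta -> exists pi : probability (E * E)%type R,
  [/\ has_law pi (proj1v : E * E -> E) alpha,
      has_law pi (proj2v : E * E -> E) beta &
      norm2 pi (fun z => proj1v z - proj2v z) <= W2_real alpha beta + eta].
Proof.
move=> Pa Pb eta0.
have [pi [l1 l2 h]] := near_optimal_coupling Pa Pb (exprn_gt0 2 eta0).
by exists pi; split => //; apply: sqrt_excess => //; exact: W2_real_ge0.
Qed.

Lemma W2_real_sym alpha beta : P2 alpha -> P2 beta ->
  W2_real alpha beta = W2_real beta alpha.
Proof.
suff le a b : P2 a -> P2 b -> W2_real a b <= W2_real b a.
  by move=> Pa Pb; apply/eqP; rewrite eq_le !le.
move=> Pa Pb; apply/ler_addgt0Pr => e e0.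
have [pi [l1 l2 h]] := near_optimal_norm Pb Pa e0.
by apply: le_trans h; rewrite norm2BC; exact: W2_real_le.
Qed.

End wasserstein.

(** * Gluing along a finite partition *)

Section density.
Context {R : realType} {dT} {T : measurableType dT}.
Variables (mu : {measure set T -> \bar R}) (h : T -> R).
Hypothesis mh : measurable_fun setT h.
Hypothesis h0 : forall t, 0 <= h t.
Local Open Scope ereal_scope.

(** The proofs are arguments so that the measure structure can be attached to
    the set function. *)
Definition density_measure & measurable_fun setT h & (forall t, (0 <= h t)%R) :=
  fun A : set T => \int[mu]_(t in A) (h t)%:E.

Local Notation nu := (density_measure mh h0).

Let nu0 : nu set0 = 0. Proof. exact: integral_set0. Qed.

Let nu_ge0 A : 0 <= nu A.
Proof. by apply: integral_ge0 => t _; rewrite lee_fin. Qed.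

Let nu_sigma_additive : semi_sigma_additive nu.
Proof.
apply: semi_sigma_additive_nng_induced; first exact/measurable_EFinP.
by move=> t; rewrite lee_fin.
Qed.

HB.instance Definition _ := isMeasure.Build _ _ _ nu nu0 nu_ge0
  nu_sigma_additive.

Let integral_density_indic A : measurable A ->
  \int[nu]_t (\1_A t)%:E = \int[mu]_t ((\1_A t)%:E * (h t)%:E).
Proof.
move=> mA; rewrite integral_indic// setIT.
rewrite /= /density_measure integral_mkcond; apply: eq_integral => t _.
by rewrite patchE indicE; case: ifP; rewrite ?mul1e ?mul0e.
Qed.

Import HBNNSimple.

Let integral_density_nnsfun (f : {nnsfun T >-> R}) :
  \int[nu]_t (f t)%:E = \int[mu]_t ((f t)%:E * (h t)%:E).
Proof.
under [LHS]eq_integral do rewrite fimfunE -fsumEFin//.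
rewrite [LHS]ge0_integral_fsum//; last 2 first.
- by move=> r; exact/measurable_EFinP/measurableT_comp.
- by move=> n x _; rewrite EFinM nnfun_muleindic_ge0.
under [RHS]eq_integral.
  move=> t _; rewrite fimfunE -fsumEFin// ge0_mule_fsuml; last first.
    by move=> r; rewrite EFinM nnfun_muleindic_ge0.
  over.
rewrite [RHS]ge0_integral_fsum//; last 2 first.
- move=> r; apply: emeasurable_funM; last exact/measurable_EFinP.
  exact/measurable_EFinP/measurableT_comp.
- by move=> r t _; rewrite mule_ge0 ?lee_fin// -lee_fin EFinM nnfun_muleindic_ge0.
apply: eq_fsbigr => r _.
rewrite integralZl_indic_nnsfun// integral_density_indic//.
have [r0|r0] := ltP r 0%R.
  rewrite preimage_nnfun0//.
  under eq_integral do rewrite indic0 mul0e.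
  rewrite integral0 mule0; under eq_integral do rewrite indic0 mulr0 mul0e.
  by rewrite integral0.
rewrite -ge0_integralZl//.
- by apply: eq_integral => t _; rewrite EFinM muleA.
- apply: emeasurable_funM; last exact/measurable_EFinP.
  exact/measurable_EFinP.
- by move=> t _; rewrite mule_ge0 ?lee_fin.
Qed.

Lemma ge0_integral_density (f : T -> \bar R) : measurable_fun setT f ->
  (forall t, 0 <= f t) ->
  \int[nu]_t f t = \int[mu]_t (f t * (h t)%:E).
Proof.
move=> mf f0; pose f_ := nnsfun_approx measurableT mf.
have fE t : f t = limn (fun n => (f_ n t)%:E).
  by apply/esym/cvg_lim => //=; exact: cvg_nnsfun_approx.
transitivity (limn (fun n => \int[nu]_t (f_ n t)%:E)).
  rewrite -monotone_convergence//=.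
  - by apply: eq_integral => t _; rewrite fE.
  - by move=> n; exact/measurable_EFinP.
  - by move=> n x _; rewrite lee_fin.
  - by move=> x _ a b ab; rewrite lee_fin//; exact/lefP/nd_nnsfun_approx.
rewrite (_ : \int[mu]_t _ =
    limn (fun n => \int[mu]_t ((f_ n t)%:E * (h t)%:E))).
  by congr (limn _); apply/funext => n; exact: integral_density_nnsfun.
rewrite -monotone_convergence//=.
- apply: eq_integral => t _; apply/esym/cvg_lim => //=.
  apply: cvgeZr => //.
  exact: cvg_nnsfun_approx.
- by move=> n; apply: emeasurable_funM; exact/measurable_EFinP.
- by move=> n t _; rewrite mule_ge0 ?lee_fin.
- move=> t _ a b ab; rewrite lee_wpmul2r ?lee_fin//.
  exact/lefP/nd_nnsfun_approx.
Qed.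

Lemma density_probability : \int[mu]_t (h t)%:E = 1 ->
  exists Q : probability T R, forall f : T -> \bar R,
    measurable_fun setT f -> (forall t, 0 <= f t) ->
    \int[Q]_t f t = \int[mu]_t (f t * (h t)%:E).
Proof.
move=> h1; pose mx := Measure_isProbability.Build _ _ _ nu h1.
pose Q : probability T R := HB.pack nu mx.
by exists Q => f mf f0; rewrite -ge0_integral_density.
Qed.

End density.

Section gluing.
Context {R : realType} {d1 d2} {T1 : measurableType d1} {T2 : measurableType d2}.
Variables (Q1 : probability T1 R) (Q2 : probability T2 R).
Variables (n : nat) (J : T1 -> 'I_n) (m : 'I_n -> R) (s : 'I_n -> T2 -> R).
Hypothesis mJ : forall i, measurable (J @^-1` [set i]).
Hypothesis PJ : forall i, Q1 (J @^-1` [set i]) = (m i)%:E.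
Hypothesis m0 : forall i, 0 < m i.
Hypothesis ms : forall i, measurable_fun setT (s i).
Hypothesis s0 : forall i t, 0 <= s i t.
Hypothesis s1 : forall t, \sum_i s i t = 1.
Hypothesis sm : forall i, (\int[Q2]_t (s i t)%:E = (m i)%:E)%E.

Let h (z : T1 * T2) : R := s (J z.1) z.2 / m (J z.1).

Let hE z : h z = \sum_i \1_(J @^-1` [set i]) z.1 * (s i z.2 / m i).
Proof.
rewrite (bigD1 (J z.1))//= big1 => [|i iJ].
  by rewrite addr0 indicE mem_set// mul1r.
by rewrite indicE memNset ?mul0r// => /esym/eqP; rewrite (negbTE iJ).
Qed.

Let h_ge0 z : 0 <= h z.
Proof. by rewrite divr_ge0// ltW. Qed.

Let mh : measurable_fun setT h.
Proof.
rewrite (_ : h = fun z => \sum_i \1_(J @^-1` [set i]) z.1 * (s i z.2 / m i)).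
  apply: measurable_sum => i; apply: measurable_funM.
    by apply: (measurableT_comp _ measurable_fst) => //; exact: measurable_indic.
  apply: measurable_funM => //.
  exact: (measurableT_comp (ms i) measurable_snd).
by apply/funext => z; exact: hE.
Qed.

Let int_s2 (g : T2 -> \bar R) : measurable_fun setT g ->
  (forall t, 0 <= g t)%E -> forall t1 : T1,
  (\int[Q2]_t (g t * (h (t1, t))%:E) =
    (m (J t1))^-1%:E * \int[Q2]_t ((s (J t1) t)%:E * g t))%E.
Proof.
move=> mg g0 t1; rewrite -ge0_integralZl//.
- by apply: eq_integral => t _; rewrite /h/= mulrC EFinM muleC -muleA.
- by apply: emeasurable_funM => //; exact/measurable_EFinP.
- by move=> t _; rewrite mule_ge0// lee_fin.
- by rewrite lee_fin invr_ge0 ltW.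
Qed.

Let int_h t1 : (\int[Q2]_t (h (t1, t))%:E = 1)%E.
Proof.
have := int_s2 (g := cst 1%E) (measurable_cst _) (fun=> lee01) t1.
under eq_integral do rewrite mul1e.
move=> ->; under eq_integral do rewrite mule1.
by rewrite sm -EFinM mulVf// gt_eqF.
Qed.

(** Conditionally on the event J = i the two components are made independent,
    the second one having density s i / m i with respect to Q2. *)
Lemma glue_soft : exists Q : probability (T1 * T2)%type R,
  [/\ has_law Q fst Q1, has_law Q snd Q2 &
    forall i (g : T2 -> \bar R), measurable_fun setT g ->
      (forall t, 0 <= g t)%E ->
      (\int[Q]_z ((\1_(J @^-1` [set i]) z.1)%:E * g z.2) =
       \int[Q2]_t ((s i t)%:E * g t))%E].
Proof.
have mhE : measurable_fun setT (EFin \o h) by exact/measurable_EFinP.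
have hE0 z : (0 <= (EFin \o h) z)%E by rewrite lee_fin.
have h1 : (\int[Q1 \x Q2]_z (h z)%:E = 1)%E.
  rewrite (fubini_tonelli1 (EFin \o h))//.
  under eq_integral do rewrite /fubini_F/= int_h.
  rewrite integral_cst// mul1e.
  exact: probability_setT.
have [Q QE] := density_probability mh h_ge0 h1.
have QJ i (g : T2 -> \bar R) : measurable_fun setT g ->
    (forall t, 0 <= g t)%E ->
    (\int[Q]_z ((\1_(J @^-1` [set i]) z.1)%:E * g z.2) =
     \int[Q2]_t ((s i t)%:E * g t))%E.
  move=> mg g0.
  have m1 : measurable_fun setT
      (fun z : T1 * T2 => (\1_(J @^-1` [set i]) z.1)%:E : \bar R)%E.
    apply/measurable_EFinP.
    by apply: (measurableT_comp _ measurable_fst) => //; exact: measurable_indic.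
  have m2 : measurable_fun setT
      (fun z : T1 * T2 => (\1_(J @^-1` [set i]) z.1)%:E * g z.2)%E.
    apply: emeasurable_funM => //.
    exact: (measurableT_comp mg measurable_snd).
  rewrite QE//; last by move=> z; rewrite mule_ge0// lee_fin.
  rewrite (fubini_tonelli1 (fun z => _ * g z.2 * _)%E)/=; last 2 first.
  - by apply: emeasurable_funM.
  - by move=> z; rewrite !mule_ge0// lee_fin.
  rewrite /fubini_F/=.
  transitivity (\int[Q1]_t1 ((m i)^-1%:E * \int[Q2]_t ((s i t)%:E * g t) *
     (\1_(J @^-1` [set i]) t1)%:E))%E.
    apply: eq_integral => t1 _.
    under eq_integral do rewrite -muleA.
    rewrite ge0_integralZl//; last 2 first.
    - apply: emeasurable_funM => //.
      by apply: (measurableT_comp mhE); exact: measurable_pair1.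
    - by move=> t _; rewrite mule_ge0// lee_fin.
    rewrite int_s2// muleC indicE.
    have [/set_mem/= <-//|_] := boolP (t1 \in _).
    by rewrite !mule0.
  have K0 : (0 <= \int[Q2]_t ((s i t)%:E * g t))%E.
    by apply: integral_ge0 => t _; rewrite mule_ge0// lee_fin.
  rewrite ge0_integralZl//.
  - rewrite integral_indic// setIT [X in (_ * X = _)%E](PJ i) muleAC -EFinM.
    rewrite mulVf ?mul1e//.
    by rewrite gt_eqF.
  - by apply/measurable_EFinP; exact: measurable_indic.
  - by rewrite mule_ge0// lee_fin invr_ge0 ltW.
exists Q; split => //.
- split; first exact: measurable_fst.
  move=> A mA.
  have mA' : measurable (fst @^-1` A : set (T1 * T2)).
    by rewrite -[X in measurable X]setTI; exact: measurable_fst.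
  transitivity (\int[Q]_z (\1_(fst @^-1` A) z)%:E)%E.
    by rewrite integral_indic// setIT.
  rewrite QE//; last by apply/measurable_EFinP; exact: measurable_indic.
  rewrite (fubini_tonelli1 (fun z => _ * (h z)%:E)%E)/=; last 2 first.
  - apply: emeasurable_funM => //.
    by apply/measurable_EFinP; exact: measurable_indic.
  - by move=> z; rewrite mule_ge0// lee_fin.
  transitivity (\int[Q1]_t (\1_A t)%:E)%E; last by rewrite integral_indic// setIT.
  apply: eq_integral => t1 _; rewrite /fubini_F/=.
  transitivity (\int[Q2]_y ((\1_A t1)%:E * (h (t1, y))%:E))%E.
    by apply: eq_integral => y _; rewrite !indicE.
  rewrite ge0_integralZl//.
  - by rewrite int_h mule1.
  - by apply: (measurableT_comp mhE); exact: measurable_pair1.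
  - by move=> t _; rewrite lee_fin.
- split; first exact: measurable_snd.
  move=> B mB.
  have mB' : measurable (snd @^-1` B : set (T1 * T2)).
    by rewrite -[X in measurable X]setTI; exact: measurable_snd.
  have mB1 : measurable_fun setT (fun t => (\1_B t)%:E : \bar R)%E.
    by apply/measurable_EFinP; exact: measurable_indic.
  transitivity (\int[Q]_z (\1_(snd @^-1` B) z)%:E)%E.
    by rewrite integral_indic// setIT.
  transitivity (\int[Q]_z \sum_i ((\1_(J @^-1` [set i]) z.1)%:E *
      (\1_B z.2)%:E))%E.
    apply: eq_integral => z _; rewrite (bigD1 (J z.1))//= big1 => [|i iJ].
      by rewrite adde0 !indicE (mem_set (erefl (J z.1) : _ z.1)) mul1e.
    rewrite [X in (X%:E * _)%E]indicE memNset ?mul0e// => /esym/eqP.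
    by rewrite (negbTE iJ).
  rewrite ge0_integral_sum//; last first.
    move=> i; apply: emeasurable_funM.
      apply/measurable_EFinP.
      by apply: (measurableT_comp _ measurable_fst) => //; exact: measurable_indic.
    exact: (measurableT_comp mB1 measurable_snd).
  rewrite (eq_bigr (fun i => \int[Q2]_t ((s i t)%:E * (\1_B t)%:E))%E); last first.
    by move=> i _; rewrite (QJ i (fun t => (\1_B t)%:E))%E.
  rewrite -ge0_integral_sum//; last 2 first.
  - by move=> i; apply: emeasurable_funM => //; exact/measurable_EFinP.
  - by move=> i z _; rewrite mule_ge0// lee_fin.
  transitivity (\int[Q2]_t (\1_B t)%:E)%E; last by rewrite integral_indic// setIT.
  apply: eq_integral => t _.
  under eq_bigr do rewrite -EFinM.
  by rewrite sumEFin -mulr_suml s1 mul1r.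
Qed.

(** The gluing identity for signed integrands: decompose over the cells of J,
    then into positive and negative parts. *)
Lemma glue_Rintegral (Q : probability (T1 * T2)%type R) (G : 'I_n -> T2 -> R) :
  (forall i (g : T2 -> \bar R), measurable_fun setT g ->
      (forall t, 0 <= g t)%E ->
      (\int[Q]_z ((\1_(J @^-1` [set i]) z.1)%:E * g z.2) =
       \int[Q2]_t ((s i t)%:E * g t))%E) ->
  (forall i, Q2.-integrable setT (EFin \o G i)) ->
  \int[Q]_z G (J z.1) z.2 = \sum_i \int[Q2]_t (s i t * G i t).
Proof.
move=> QJ iG.
have s_le1 i t : s i t <= 1.
  by rewrite -(s1 t) (bigD1 i)//= lerDl; apply: sumr_ge0.
have m1 i : measurable_fun setT
    (fun z : T1 * T2 => \1_(J @^-1` [set i]) z.1 : R).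
  by apply: (measurableT_comp _ measurable_fst) => //; exact: measurable_indic.
have pos i (g : T2 -> R) : Q2.-integrable setT (EFin \o g) ->
    (forall t, 0 <= g t) ->
    Q.-integrable setT
      (EFin \o (fun z => \1_(J @^-1` [set i]) z.1 * g z.2)) /\
    \int[Q]_z (\1_(J @^-1` [set i]) z.1 * g z.2) = \int[Q2]_t (s i t * g t).
  move=> ig g0; have mg := measurable_int Q2 ig.
  have mg' : measurable_fun setT g by exact/measurable_EFinP.
  have sg : Q2.-integrable setT (EFin \o (fun t => s i t * g t)).
    apply: (integrable_dominated _ _ ig); first exact: measurable_funM.
    by move=> t; rewrite ger0_norm ?mulr_ge0// ler_piMl.
  have E : (\int[Q]_z (\1_(J @^-1` [set i]) z.1 * g z.2)%:E =
      \int[Q2]_t (s i t * g t)%:E)%E.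
    under eq_integral do rewrite EFinM.
    by rewrite (QJ i (EFin \o g)).
  split; last by rewrite /Rintegral E.
  apply/integrableP; split.
    apply/measurable_EFinP; apply: measurable_funM => //.
    exact: (measurableT_comp mg' measurable_snd).
  under eq_integral do rewrite /= ger0_norm ?mulr_ge0//.
  by rewrite E ltey_eq; apply/orP; left; exact: (integrable_fin_num _ sg).
have each i : Q.-integrable setT
      (EFin \o (fun z => \1_(J @^-1` [set i]) z.1 * G i z.2)) /\
    \int[Q]_z (\1_(J @^-1` [set i]) z.1 * G i z.2) =
    \int[Q2]_t (s i t * G i t).
  have GE t : G i t = (G i)^\+ t - (G i)^\- t.
    exact/esym/(congr1 (fun f : T2 -> R => f t) (funrposBneg (G i))).
  have ip := integrable_funrpos measurableT (iG i).
  have ineg := integrable_funrneg measurableT (iG i).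
  have [p1 p2] := pos i _ ip (funrpos_ge0 _).
  have [n1 n2] := pos i _ ineg (funrneg_ge0 _).
  have sint (g : T2 -> R) : Q2.-integrable setT (EFin \o g) ->
      Q2.-integrable setT (EFin \o (fun t => s i t * g t)).
    move=> ig; have mg' : measurable_fun setT g.
      by apply/measurable_EFinP; exact: measurable_int ig.
    apply: (integrable_dominated _ _ (integrable_norm ig)).
      exact: measurable_funM.
    by move=> t; rewrite normrM (ger0_norm (s0 i t)) ler_piMl.
  split.
    have := integrableB measurableT p1 n1; apply: eq_integrable => // z _ /=.
    by rewrite -EFinB -mulrBr -GE.
  transitivity (\int[Q]_z (\1_(J @^-1` [set i]) z.1 * (G i)^\+ z.2
     - \1_(J @^-1` [set i]) z.1 * (G i)^\- z.2)).
    by apply: eq_Rintegral => z _; rewrite -mulrBr -GE.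
  rewrite RintegralB// p2 n2 -RintegralB//; last 2 first.
  - exact: sint.
  - exact: sint.
  by apply: eq_Rintegral => t _; rewrite -mulrBr -GE.
transitivity (\int[Q]_z (\sum_i \1_(J @^-1` [set i]) z.1 * G i z.2)).
  apply: eq_Rintegral => z _; rewrite (bigD1 (J z.1))//= big1 => [|i iJ].
    by rewrite addr0 indicE mem_set// mul1r.
  by rewrite indicE memNset ?mul0r// => /esym/eqP; rewrite (negbTE iJ).
rewrite /Rintegral; under eq_integral do rewrite -sumEFin.
rewrite integral_sum//; last by move=> i; exact: (each i).1.
rewrite -sum_fine => [|i _]; last exact: (integrable_fin_num _ (each i).1).
by apply: eq_bigr => i _; exact: (each i).2.
Qed.

End gluing.

(** * Discretization and the triangle inequality *)

Section finite_valued.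
Context {R : realType} {d : nat} {dT} {T : measurableType dT}.
Variable P : probability T R.

Lemma finite_valued_sumE n (J : T -> 'I_n) (a : 'I_n -> R) t :
  a (J t) = \sum_j \1_(J @^-1` [set j]) t * a j.
Proof.
rewrite (bigD1 (J t))//= big1 => [|i iJ].
  by rewrite addr0 indicE mem_set// mul1r.
by rewrite indicE memNset ?mul0r// => /esym/eqP; rewrite (negbTE iJ).
Qed.

Lemma square_integrable_finite n (J : T -> 'I_n) (q : 'I_n -> 'rV[R]_d) :
  (forall i, measurable (J @^-1` [set i])) ->
  square_integrable P (fun t => q (J t)).
Proof.
move=> mJ.
have mq : measurable_fun setT ((fun t => q (J t)) : T -> euclid R d).
  apply: measurable_to_euclid => i.
  under eq_fun do rewrite (finite_valued_sumE J (fun j => q j ord0 i)).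
  by apply: measurable_sum => j; apply: measurable_funM.
split => //.
have := finite_measure_integrable_cst P (\sum_j sqnorm (q j)) measurableT.
apply: integrable_dominated => [|t]; first exact: measurable_sqnorm.
rewrite ger0_norm ?sqnorm_ge0// (bigD1 (J t))//= lerDl.
by apply: sumr_ge0 => i _; exact: sqnorm_ge0.
Qed.

(** Cells of probability zero are discarded; their points are sent to some other
    cell, which changes J on a null set only. *)
Lemma positive_cells n (J : T -> 'I_n) :
  (forall i, measurable (J @^-1` [set i])) ->
  exists n' (f : 'I_n' -> 'I_n) (J' : T -> 'I_n'),
  [/\ forall i, measurable (J' @^-1` [set i]),
      forall i, (0 < P (J' @^-1` [set i]))%E &
      {ae P, forall t, f (J' t) = J t}].
Proof.
move=> mJ; pose S := [pred i | (0 < P (J @^-1` [set i]))%E].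
have mpre (A : set 'I_n) : measurable (J @^-1` A).
  rewrite (_ : J @^-1` A = \bigcup_(i in A) J @^-1` [set i]).
    by apply: fin_bigcup_measurable => // i _.
  by apply/seteqP; split=> [t At|t [i Ai /= Jt]]; [exists (J t)|rewrite /= Jt].
have nullS : P (J @^-1` [set i | i \notin S]) = 0%E.
  rewrite (_ : J @^-1` _ = \bigcup_(i in [set i | i \notin S]) J @^-1` [set i]);
    last by apply/seteqP; split=> [t At|t [i Ai /= Jt]]; [exists (J t)|rewrite /= Jt].
  have h : (P (\bigcup_(i in [set i | i \notin S]) J @^-1` [set i]) <=
      \sum_(i \in [set i | i \notin S]) P (J @^-1` [set i]))%E.
    apply: content_sub_fsum => //; first exact: finite_finset.
    by apply: fin_bigcup_measurable => //; exact: finite_finset.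
  apply/eqP; rewrite -measure_le0; apply: le_trans h _.
  rewrite fsbig1// => i /=; rewrite inE -leNgt => iS.
  by apply/eqP; rewrite -measure_le0.
have [i0 i0S] : exists i, i \in S.
  apply: contrapT => /forallNP h.
  have : P (J @^-1` [set i | i \notin S]) = 1%E.
    rewrite (_ : _ @^-1` _ = setT) ?probability_setT//.
    by apply/seteqP; split => // t _ /=; apply/negP; exact: h.
  by rewrite nullS => /eqP; rewrite eq_sym onee_eq0.
exists #|S|, (@enum_val _ S), (fun t => enum_rank_in i0S (J t)); split.
- by move=> i; exact: (mpre [set j | enum_rank_in i0S j = i]).
- move=> i; have := enum_valP i; rewrite inE => /lt_le_trans; apply.
  apply: le_measure; rewrite ?inE//.
    exact: (mpre [set j | enum_rank_in i0S j = i]).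
  by move=> t /= ->; exact: enum_valK_in.
- exists (J @^-1` [set i | i \notin S]); split => // t /= h.
  by apply/negP => Jt; apply: h; exact: enum_rankK_in.
Qed.

End finite_valued.

Section discretization.
Context {R : realType} {d : nat} {dT} {T : measurableType dT}.
Variable P : probability T R.
Variable X : T -> 'rV[R]_d.
Hypothesis sX : square_integrable P X.

Definition dense_point (k : nat) : 'rV[R]_d :=
  if k is k'.+1 then oapp (@rat_point R d) 0 (unpickle k') else 0.

Lemma dense_pointP (x : 'rV[R]_d) (e : R) : 0 < e ->
  exists k, sqnorm (x - dense_point k) <= e.
Proof.
move=> e0; pose c : R := Num.min 1 (e / d.+1%:R).
have c0 : 0 < c by rewrite lt_min ltr01 divr_gt0.
have [q qP] := rat_point_dense x c0.
exists (pickle q).+1; rewrite /dense_point pickleK/=.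
apply: (@le_trans _ _ (\sum_(i < d) e / d.+1%:R)).
  apply: ler_sum => i _; rewrite !mxE.
  apply: (@le_trans _ _ c); last by rewrite ge_min lexx orbT.
  have := qP i; rewrite mxE -real_normK ?num_real//.
  have c1 : c <= 1 by rewrite ge_min lexx.
  by have := normr_ge0 (x ord0 i - ratr (q ord0 i)); nra.
rewrite sumr_const card_ord -[_ *+ d]mulr_natr -mulrA ler_piMr ?(ltW e0)//.
by rewrite mulrC ler_pdivrMr// mul1r ler_nat.
Qed.

(** Index, among the first N + 1 points of a dense sequence, of a point nearest
    to X; the first point being 0, the distance never exceeds |X|. *)
Fixpoint nearest (N : nat) (t : T) : nat :=
  if N is N'.+1 then
    if sqnorm (X t - dense_point N'.+1)
       < sqnorm (X t - dense_point (nearest N' t))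
    then N'.+1 else nearest N' t
  else 0%N.

Let r N t := sqnorm (X t - dense_point (nearest N t)).

Let rS N t : r N.+1 t = Num.min (sqnorm (X t - dense_point N.+1)) (r N t).
Proof. by rewrite /r/= minElt; case: ifP. Qed.

Lemma nearest_le N t : (nearest N t <= N)%N.
Proof. by elim: N => //= N IH; case: ifP => // _; exact: leqW. Qed.

Let r_le N k t : (k <= N)%N -> r N t <= sqnorm (X t - dense_point k).
Proof.
elim: N => [|N IH]; first by rewrite leqn0 => /eqP ->.
rewrite rS leq_eqVlt => /orP[/eqP ->|kN]; rewrite ge_min ?lexx//.
by rewrite IH ?orbT.
Qed.

Let mXc (x : 'rV[R]_d) : measurable_fun setT (fun t => sqnorm (X t - x)).
Proof. by apply: measurable_sqnorm; apply: measurable_rvB => //; exact: sX.1. Qed.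

Let mr N : measurable_fun setT (r N).
Proof.
elim: N => [|N IH]; first exact: mXc.
have -> : r N.+1 = fun t => Num.min (sqnorm (X t - dense_point N.+1)) (r N t).
  by apply/funext => t; exact: rS.
by apply: measurable_minr => //; exact: mXc.
Qed.

Lemma measurable_nearest N : measurable_fun setT (nearest N).
Proof.
elim: N => [|N IH] /=; first exact: measurable_cst.
apply: measurable_fun_ifT => //; apply: measurable_fun_ltr; first exact: mXc.
exact: mr.
Qed.

Let r0_le N t : `|r N t| <= sqnorm (X t).
Proof.
rewrite ger0_norm ?sqnorm_ge0//; have := r_le t (leq0n N).
by rewrite /= subr0.
Qed.

Let r_integrable N : P.-integrable setT (EFin \o r N).
Proof. exact: integrable_dominated (mr N) (r0_le N) sX.2. Qed.

Let r_cvg : (fun N => \int[P]_t (r N t)%:E)%E @ \oo --> 0%E.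
Proof.
have mE N : measurable_fun setT (EFin \o r N) by exact/measurable_EFinP.
have cvg0 : {ae P, forall t, [set: T] t ->
    (fun N => (r N t)%:E) @ \oo --> (cst 0%E : T -> \bar R) t}.
  apply/nearW => t _; apply/fine_cvgP; split; first exact: nearW.
  apply/cvgrPdist_le => /= e e0; have [k hk] := dense_pointP (X t) e0.
  near=> N; rewrite sub0r normrN ger0_norm ?sqnorm_ge0//.
  apply: le_trans hk; apply: r_le; near: N; exact: nbhs_infty_ge.
have bound : {ae P, forall t N, [set: T] t ->
    (`|(r N t)%:E| <= (sqnorm (X t))%:E)%E}.
  by apply/nearW => t N _ /=; rewrite lee_fin.
have [_ _] := dominated_convergence measurableT mE (measurable_cst _)
  cvg0 sX.2 bound.
by rewrite integral_cst// mul0e.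
Unshelve. all: by end_near. Qed.

(** Dominated convergence along the nearest points of a dense sequence. That the
    cells have positive probability makes the dual functional below coercive. *)
Lemma discretize (delta : R) : 0 < delta ->
  exists n (q : 'I_n -> 'rV[R]_d) (J : T -> 'I_n) (m : 'I_n -> R),
  [/\ forall i, measurable (J @^-1` [set i]),
      forall i, P (J @^-1` [set i]) = (m i)%:E,
      forall i, 0 < m i &
      norm2 P (fun t => X t - q (J t)) <= delta].
Proof.
move=> delta0.
have [N rN] : exists N, \int[P]_t r N t <= delta ^+ 2.
  have /fine_cvgP[_ /cvgrPdist_le /(_ (delta ^+ 2))] := r_cvg.
  rewrite exprn_gt0// => /(_ isT)[N _ /(_ N (leqnn N))] /=.
  by rewrite sub0r normrN => /(le_trans (ler_norm _)); exists N.
pose J0 t : 'I_N.+1 := inord (nearest N t).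
have J0E t : J0 t = nearest N t :> nat by rewrite inordK// ltnS nearest_le.
have mJ0 i : measurable (J0 @^-1` [set i]).
  rewrite (_ : J0 @^-1` _ = nearest N @^-1` [set val i]).
    rewrite -[X in measurable X]setTI; exact: measurable_nearest.
  apply/seteqP; split=> t /=; first by move=> <-.
  by move=> h; apply: val_inj; rewrite /= J0E.
have [n [f [J [mJ PJ fJ]]]] := positive_cells P mJ0.
exists n, (fun i => dense_point (f i)), J, (fun i => fine (P (J @^-1` [set i]))).
split => //.
- by move=> i; rewrite fineK// fin_num_measure.
- by move=> i; rewrite fine_gt0// PJ/= ltey_eq fin_num_measure.
apply: norm2_le; first exact: ltW.
apply: le_trans rN; rewrite /inner /Rintegral.
rewrite le_eqVlt; apply/orP; left; apply/eqP; congr fine.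
have sq := square_integrable_finite P (fun i => dense_point (f i)) mJ.
apply: ae_eq_integral => //.
- have sXq := square_integrableB sX sq.
  exact: (measurable_int P (integrable_dotv sXq sXq)).
- exact: measurable_int (r_integrable N).
- apply: filterS fJ => t fJt _.
  by rewrite /r -sqnormE fJt J0E.
Qed.

End discretization.

Section approximate_gluing.
Context {R : realType} {d : nat} {d1 d2} {T1 : measurableType d1}
  {T2 : measurableType d2}.
Variables (Q1 : probability T1 R) (Q2 : probability T2 R).
Variables (X1 : T1 -> 'rV[R]_d) (X2 : T2 -> 'rV[R]_d).
Variable alpha : probability (euclid R d) R.
Hypothesis Pa : P2 alpha.
Hypothesis lX1 : has_law Q1 (X1 : T1 -> euclid R d) alpha.
Hypothesis lX2 : has_law Q2 (X2 : T2 -> euclid R d) alpha.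

(** Two couplings sharing a marginal alpha are glued along the cells of a fine
    finite partition of the space: the middle variables then only agree up to
    delta in L2, but no disintegration is involved. *)
Lemma approximate_gluing (delta : R) : 0 < delta ->
  exists Q : probability (T1 * T2)%type R,
  [/\ has_law Q fst Q1, has_law Q snd Q2 &
      norm2 Q (fun z => X1 z.1 - X2 z.2) <= delta].
Proof.
move=> delta0; have sid := P2_square_integrable Pa.
have delta2 : 0 < delta / 2 by lra.
have [n [q [J [m [mJ PJ m0 qJ]]]]] := discretize sid delta2.
pose J1 t := J (X1 t); pose J2 t := J (X2 t).
have mJ1 i : measurable (J1 @^-1` [set i]).
  by rewrite -[X in measurable X]setTI; exact: (lX1.1 _ _ (mJ i)).
have mJ2 i : measurable (J2 @^-1` [set i]).
  by rewrite -[X in measurable X]setTI; exact: (lX2.1 _ _ (mJ i)).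
have PJ1 i : Q1 (J1 @^-1` [set i]) = (m i)%:E.
  by rewrite -PJ -lX1.2.
have PJ2 i : Q2 (J2 @^-1` [set i]) = (m i)%:E.
  by rewrite -PJ -lX2.2.
pose s i t : R := \1_(J2 @^-1` [set i]) t.
have s1 t : \sum_i s i t = 1.
  have := finite_valued_sumE J2 (fun=> 1) t; rewrite [RHS]/= => ->.
  by apply: eq_bigr => i _; rewrite mulr1.
have sm i : (\int[Q2]_t (s i t)%:E = (m i)%:E)%E.
  by rewrite integral_indic// setIT; exact: PJ2.
have ms i : measurable_fun setT (s i) by exact: measurable_indic.
have s0 i t : 0 <= s i t by rewrite /s.
have [Q [lQ1 lQ2 QJ]] := glue_soft mJ1 PJ1 m0 ms s0 s1 sm.
exists Q; split => //.
have l1 := has_law_comp lQ1 lX1; have l2 := has_law_comp lQ2 lX2.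
pose A (z : T1 * T2) := q (J (X1 z.1)).
pose B (z : T1 * T2) := q (J (X2 z.2)).
have sq := square_integrable_finite alpha q mJ.
have sA : square_integrable Q A := square_integrable_comp l1 sq.
have sB : square_integrable Q B := square_integrable_comp l2 sq.
have sX1 := law_square_integrable l1 Pa; have sX2 := law_square_integrable l2 Pa.
have h1 : norm2 Q (fun z => X1 z.1 - A z) <= delta / 2.
  by rewrite (norm2_comp l1 (square_integrableB sid sq).1).
have h2 : norm2 Q (fun z => B z - X2 z.2) <= delta / 2.
  by rewrite norm2BC (norm2_comp l2 (square_integrableB sid sq).1).
(* almost surely for the glued measure, both vectors lie in the same cell *)
have h3 : norm2 Q (fun z => A z - B z) <= 0.
  apply: norm2_le => //; rewrite expr0n/= /inner.
  have := glue_Rintegral mJ1 ms s0 s1 (G := fun i t =>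
    dotv (q i - q (J (X2 t))) (q i - q (J (X2 t)))) QJ.
  rewrite /A /B => ->.
    rewrite big1// => i _; rewrite (_ : (fun t => _) = cst 0).
      by rewrite Rintegral_cst// mul0r.
    apply/funext => t; rewrite /s indicE.
    have [/set_mem <-|] := boolP (t \in _); last by rewrite mul0r.
    by rewrite -sqnormE subrr sqnorm0 mulr0.
  move=> i; apply: integrable_dotv; apply: square_integrableB.
  - exact: (square_integrable_finite Q2 (fun=> q i) mJ2).
  - exact: (square_integrable_comp lX2 sq).
  - exact: (square_integrable_finite Q2 (fun=> q i) mJ2).
  - exact: (square_integrable_comp lX2 sq).
apply: le_trans (norm2_dist sX1 sA sX2) _; rewrite [delta]splitr lerD//.
by apply: le_trans (norm2_dist sA sB sX2) _; rewrite -[leRHS]add0r; exact: lerD h3 h2.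
Qed.

End approximate_gluing.

Section triangle.
Context {R : realType} {d : nat}.
Local Notation E := (euclid R d).

Lemma W2_real_triangle (beta alpha gamma : probability E R) :
  P2 alpha -> P2 beta -> P2 gamma ->
  W2_real alpha gamma <= W2_real alpha beta + W2_real beta gamma.
Proof.
move=> Pa Pb Pc; apply/ler_addgt0Pr => e e0.
have e3 : 0 < e / 3 by lra.
have [pi1 [l1 l2 h1]] := near_optimal_norm Pa Pb e3.
have [pi2 [l3 l4 h2]] := near_optimal_norm Pb Pc e3.
have [Q [lQ1 lQ2 h]] := approximate_gluing Pb l2 l3 e3.
have k1 := has_law_comp lQ1 l1; have k2 := has_law_comp lQ1 l2.
have k3 := has_law_comp lQ2 l3; have k4 := has_law_comp lQ2 l4.
have s1 := law_square_integrable k1 Pa; have s2 := law_square_integrable k2 Pb.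
have s3 := law_square_integrable k3 Pb; have s4 := law_square_integrable k4 Pc.
apply: le_trans (W2_real_le Pa Pc k1 k4) _.
have m12 : measurable_fun setT
    ((fun z : E * E => proj1v z - proj2v z) : E * E -> E).
  by apply: measurable_rvB; [exact: measurable_proj1v|exact: measurable_proj2v].
have n1 := norm2_comp lQ1 m12; have n2 := norm2_comp lQ2 m12.
rewrite -n1 in h1; rewrite -n2 in h2.
exact: (triangle_bound (norm2_dist s1 s2 s4) (norm2_dist s2 s3 s4) h1 h h2).
Qed.

End triangle.

(** * Smoothed transport duality *)

Section log_sum_exp.
Context {R : realType} {n : nat}.
Implicit Types (a b : 'I_n.+1 -> R) (i j : 'I_n.+1).

Definition sumexp a : R := \sum_i expR (a i).

Definition lse a : R := ln (sumexp a).

Definition softmax a i : R := expR (a i) / sumexp a.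

Lemma sumexp_gt0 a : 0 < sumexp a.
Proof.
by rewrite /sumexp big_ord_recl ltr_wpDr ?expR_gt0// sumr_ge0// => i _;
  exact: expR_ge0.
Qed.

Lemma expR_lse a : expR (lse a) = sumexp a.
Proof. by rewrite lnK// posrE sumexp_gt0. Qed.

Lemma lse_le a (c : R) : (lse a <= c) = (sumexp a <= expR c).
Proof. by rewrite -ler_expR expR_lse. Qed.

Lemma softmaxE a i : softmax a i = expR (a i - lse a).
Proof. by rewrite expRD expRN expR_lse. Qed.

Lemma softmax_ge0 a i : 0 <= softmax a i.
Proof. by rewrite softmaxE expR_ge0. Qed.

Lemma sum_softmax a : \sum_i softmax a i = 1.
Proof. by rewrite -mulr_suml divff// gt_eqF// sumexp_gt0. Qed.

Lemma softmax_le1 a i : softmax a i <= 1.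
Proof.
rewrite -(sum_softmax a) (bigD1 i)//= lerDl.
by apply: sumr_ge0 => j _; exact: softmax_ge0.
Qed.

Lemma le_lse a i : a i <= lse a.
Proof. by rewrite -subr_le0 -ler_expR expR0 -softmaxE softmax_le1. Qed.

Lemma lse_shift_le a b (c : R) : (forall i, a i <= b i + c) ->
  lse a <= lse b + c.
Proof.
move=> ab; rewrite lse_le expRD expR_lse mulr_suml; apply: ler_sum => i _.
by rewrite -expRD ler_expR.
Qed.

Lemma expR_convex (t x y : R) : 0 <= t -> t <= 1 ->
  expR (t * x + (1 - t) * y) <= t * expR x + (1 - t) * expR y.
Proof.
move=> t0 t1; set c := t * x + (1 - t) * y.
have tangent z : expR c * (1 + (z - c)) <= expR z.
  rewrite -[in leRHS](subrK c z) [leRHS]expRD [leRHS]mulrC.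
  by rewrite ler_pM2l ?expR_gt0// expR_ge1Dx.
have := ler_wpM2l t0 (tangent x).
have t1' : 0 <= 1 - t by lra.
have := ler_wpM2l t1' (tangent y).
have -> : (1 - t) * (expR c * (1 + (y - c))) =
   expR c - t * (expR c * (1 + (x - c))) by rewrite /c; ring.
lra.
Qed.

Lemma lse_convex a b (t : R) : 0 <= t -> t <= 1 ->
  lse (fun i => t * a i + (1 - t) * b i) <= t * lse a + (1 - t) * lse b.
Proof.
move=> t0 t1; rewrite lse_le -[leRHS]mul1r.
set c := t * lse a + (1 - t) * lse b.
rewrite -ler_pdivrMr ?expR_gt0// mulr_suml.
rewrite [leRHS](_ : 1 = \sum_i (t * softmax a i + (1 - t) * softmax b i)).
  apply: ler_sum => i _; rewrite -expRN -expRD !softmaxE.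
  rewrite (_ : _ + _ - c =
    t * (a i - lse a) + (1 - t) * (b i - lse b)); last by rewrite /c; ring.
  exact: expR_convex.
by rewrite big_split/= -!mulr_sumr !sum_softmax !mulr1 addrC subrK.
Qed.

(** The right-hand side has slope minus the softmax weight at t = 0, which turns
    minimality of the dual functional into a marginal condition. *)
Lemma lse_perturb a j (t : R) :
  lse (fun i => a i - (i == j)%:R * t)
    <= lse a + softmax a j * (expR (- t) - 1).
Proof.
rewrite lse_le expRD expR_lse.
apply: (@le_trans _ _ (sumexp a * (1 + softmax a j * (expR (- t) - 1)))).
  rewrite mulrDr mulr1 mulrA [sumexp a * _]mulrC divfK ?gt_eqF ?sumexp_gt0//.
  rewrite /sumexp (bigD1 j)//= [in leRHS](bigD1 j)//= eqxx mul1r expRD.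
  rewrite (eq_bigr (fun i => expR (a i))) => [|i /negbTE ->]; last first.
    by rewrite mul0r subr0.
  by rewrite le_eqVlt; apply/orP; left; apply/eqP; ring.
by rewrite ler_pM2l ?sumexp_gt0// expR_ge1Dx.
Qed.

(** The entropy of a probability vector is bounded; the crude bound by the
    number of entries, from x e^x >= -1, suffices. *)
Lemma softmax_mean_ge a : lse a - n.+1%:R <= \sum_i softmax a i * a i.
Proof.
have h i : softmax a i * lse a - 1 <= softmax a i * a i.
  have := expR_ge1Dx (- (a i - lse a)); rewrite expRN -softmaxE.
  have s0 : 0 < softmax a i by rewrite softmaxE expR_gt0.
  rewrite -(ler_pM2l s0) divff ?gt_eqF// => h.
  have := softmax_le1 a i; nra.
apply: le_trans (ler_sum _ (fun i _ => h i)).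
rewrite sumrB -mulr_suml sum_softmax mul1r sumr_const card_ord//.
Qed.

End log_sum_exp.

Lemma Rintegral_probability_cst {R : realType} {dT} {T : measurableType dT}
  (P : probability T R) (c : R) : \int[P]_t c = c.
Proof.
rewrite Rintegral_cst// [X in fine X](_ : _ = 1%E) ?mulr1//.
exact: probability_setT.
Qed.

Section dual_potential.
Context {R : realType} {d n : nat}.
Local Notation E := (euclid R d).
Variable nu : probability E R.
Hypothesis Pnu : P2 nu.
Variables (p : 'I_n.+1 -> 'rV[R]_d) (m : 'I_n.+1 -> R).
Hypothesis m0 : forall i, 0 < m i.
Hypothesis m1 : \sum_i m i = 1.
Implicit Types (w : 'rV[R]_n.+1) (y : 'rV[R]_d).

Definition slopes w y i : R := dotv (p i) y - w ord0 i.

Definition potential w y : R := lse (slopes w y).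

Lemma potential_convex w :
  convex_function [set: convex_lmodType 'rV[R]_d] (potential w).
Proof.
apply/convex_functionP => t x y t0 t1.
rewrite /potential (_ : slopes w _ =
    fun i => t * slopes w x i + (1 - t) * slopes w y i); last first.
  by apply/funext => i; rewrite /slopes dotvDr !dotvZr; ring.
exact: lse_convex.
Qed.

Lemma measurable_potential w :
  measurable_fun setT (potential w : E -> R).
Proof. exact: convex_measurable (potential_convex w). Qed.

Lemma integrable_dotv_cst (alpha : probability E R) (x : 'rV[R]_d) : P2 alpha ->
  alpha.-integrable setT (EFin \o (fun y : E => dotv x (y : 'rV[R]_d))).
Proof.
move=> /P2_square_integrable sid.
have scst : square_integrable alpha (fun=> x).
  split; first exact: measurable_cst.
  exact: (finite_measure_integrable_cst alpha (sqnorm x) measurableT).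
exact: integrable_dotv scst sid.
Qed.

Lemma integrable_cstR (alpha : probability E R) (c : R) :
  alpha.-integrable setT (EFin \o (fun=> c)).
Proof. exact: finite_measure_integrable_cst. Qed.

Lemma integrable_potential (alpha : probability E R) w : P2 alpha ->
  alpha.-integrable setT (EFin \o (potential w : E -> R)).
Proof.
move=> Pa.
pose g (y : E) := `|lse (fun _ : 'I_n.+1 => 0 : R)| +
  \sum_i (`|dotv (p i) (y : 'rV[R]_d)| + `|w ord0 i|).
have ig : alpha.-integrable setT (EFin \o g).
  rewrite (_ : EFin \o g = fun y => ((`|lse (fun _ : 'I_n.+1 => 0 : R)|)%:E +
    \sum_i ((`|dotv (p i) y|)%:E + (`|w ord0 i|)%:E))%E); last first.
    by apply/funext => y; rewrite /g/= EFinD -sumEFin.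
  apply: integrableD => //; first exact: integrable_cstR.
  apply: (integrable_sum measurableT) => i _.
  apply: integrableD => //; last exact: integrable_cstR.
  exact: (integrable_norm (integrable_dotv_cst (p i) Pa)).
apply: (integrable_dominated (measurable_potential w) _ ig) => y.
have bnd i : `|slopes w y i| <= \sum_j (`|dotv (p j) y| + `|w ord0 j|).
  rewrite (bigD1 i)//= (le_trans (ler_normB _ _))// lerDl.
  by apply: sumr_ge0 => j _; rewrite addr_ge0.
have up : potential w y <= g y.
  rewrite /potential /g.
  apply: le_trans (lse_shift_le (b := fun=> 0)
    (c := \sum_j (`|dotv (p j) y| + `|w ord0 j|)) _) _.
    by move=> i; rewrite add0r (le_trans (ler_norm _)).
  by rewrite lerD2r ler_norm.
have lo : - g y <= potential w y.
  apply: le_trans (le_lse _ ord0).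
  have := bnd ord0; have := ler_norm (- slopes w y ord0); rewrite normrN /g.
  by have := normr_ge0 (lse (fun _ : 'I_n.+1 => 0 : R)); lra.
by rewrite ler_norml lo.
Qed.

(** Dual functional of the transport problem of maximal correlation between nu
    and the weights m on the points p, with an entropic smoothing. *)
Definition dual w : R := \int[nu]_y potential w y + \sum_i m i * w ord0 i.

Lemma dual_le_lipschitz w w' (r : R) :
  (forall i, `|w ord0 i - w' ord0 i| <= r) -> dual w <= dual w' + 2 * r.
Proof.
move=> ww'; rewrite /dual.
have h1 : \int[nu]_y potential w y <= \int[nu]_y (potential w' y + r).
  apply: le_Rintegral => //.
  - exact: integrable_potential.
  - exact: (integrableD measurableT (integrable_potential w' Pnu)
      (integrable_cstR nu r)).
  move=> y _; apply: lse_shift_le => i; rewrite /slopes.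
  by have := ww' i; rewrite ler_norml => /andP[]; lra.
rewrite RintegralD// in h1; last 2 first.
- exact: integrable_potential.
- exact: integrable_cstR.
rewrite Rintegral_probability_cst in h1.
have h2 : \sum_i m i * w ord0 i <= \sum_i m i * w' ord0 i + r.
  rewrite -[X in _ + X]mul1r -m1 mulr_suml -big_split/=.
  apply: ler_sum => i _; rewrite -mulrDr ler_pM2l//.
  by rewrite -lerBlDl; exact: le_trans (ler_norm _) (ww' i).
by rewrite mulr_natl mulr2n [leRHS]addrACA lerD.
Qed.

Lemma dual_continuous : continuous dual.
Proof.
move=> w; suff H : forall e, 0 < e -> exists2 s, 0 < s &
    forall w', ball w s w' -> `|dual w - dual w'| < e.
  apply/cvgrPdist_lt => [|e /H[s s0 sP]]; first exact: nbhs_filter.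
  exact: (filterS sP (nbhsx_ballx w s s0)).
move=> e e0; exists (e / 3); first by lra.
move=> w' [_ ww'].
have le1 : dual w <= dual w' + 2 * (e / 3).
  by apply: dual_le_lipschitz => i; exact/ltW/(ww' ord0).
have le2 : dual w' <= dual w + 2 * (e / 3).
  by apply: dual_le_lipschitz => i; rewrite distrC; exact/ltW/(ww' ord0).
by rewrite ltr_norml; apply/andP; split; lra.
Qed.

Lemma dual_shift w (c : R) : dual (w + const_mx c) = dual w.
Proof.
suff le u (b : R) : dual (u + const_mx b) <= dual u.
  apply/eqP; rewrite eq_le le/=.
  have := le (w + const_mx c) (- c); rewrite -addrA.
  rewrite (_ : const_mx c + const_mx (- c) = 0) ?addr0//.
  by apply/rowP => i; rewrite !mxE subrr.
rewrite /dual.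
have h1 : \int[nu]_y potential (u + const_mx b) y <=
    \int[nu]_y (potential u y + (- b)).
  apply: le_Rintegral => //.
  - exact: integrable_potential.
  - exact: (integrableD measurableT (integrable_potential u Pnu)
      (integrable_cstR nu (- b))).
  by move=> y _; apply: lse_shift_le => i; rewrite /slopes !mxE opprD addrA.
rewrite RintegralD// in h1; last 2 first.
- exact: integrable_potential.
- exact: integrable_cstR.
rewrite Rintegral_probability_cst in h1.
have h2 : \sum_i m i * (u + const_mx b) ord0 i = \sum_i m i * u ord0 i + b.
  rewrite -[X in _ = _ + X]mul1r -m1 mulr_suml -big_split/=.
  by apply: eq_bigr => i _; rewrite !mxE mulrDr.
by rewrite h2; exact: shift_bound h1.
Qed.

(** Adding a constant to w changes nothing, so w may be taken nonnegative with a
    zero entry. The potential is then above one of the linear functions <p i, y>,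
    and the linear term, whose coefficients are positive, forces the minimum
    over a large box to be a global one. *)
Lemma dual_minimizer : exists w0, forall w, dual w0 <= dual w.
Proof.
pose C0 := \sum_i `|\int[nu]_y dotv (p i) y|.
have lb w i j : (forall k, 0 <= w ord0 k) -> w ord0 i = 0 ->
    m j * w ord0 j - C0 <= dual w.
  move=> w_ge0 wi; rewrite /dual.
  have h1 : \int[nu]_y dotv (p i) y <= \int[nu]_y potential w y.
    apply: le_Rintegral => //.
    - exact: integrable_dotv_cst.
    - exact: integrable_potential.
    move=> y _; apply: le_trans (le_lse _ i).
    by rewrite /slopes wi subr0.
  have h2 : m j * w ord0 j <= \sum_k m k * w ord0 k.
    rewrite (bigD1 j)//= lerDl; apply: sumr_ge0 => k _.
    by rewrite mulr_ge0// ltW.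
  have h3 : `|\int[nu]_y dotv (p i) y| <= C0.
    by rewrite /C0 (bigD1 i)//= lerDl; exact: sumr_ge0.
  have := ler_norm (- \int[nu]_y dotv (p i) y); rewrite normrN.
  lra.
pose M := \sum_j (C0 + `|dual 0|) / m j.
have C00 : 0 <= C0 by apply: sumr_ge0.
have MP j : C0 + `|dual 0| <= m j * M.
  rewrite mulrC -ler_pdivrMr// /M (bigD1 j)//= lerDl.
  by apply: sumr_ge0 => k _; rewrite divr_ge0 ?addr_ge0// ltW.
have M_ge0 : 0 <= M.
  by apply: sumr_ge0 => k _; rewrite divr_ge0 ?addr_ge0// ltW.
pose box := [set w : 'rV[R]_n.+1 | forall i, `[0, M]%classic (w ord0 i)].
have box0 : box 0 by move=> i; rewrite /= mxE in_itv/= lexx M_ge0.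
have cbox : compact box := rV_compact (fun _ => @segment_compact R 0 M).
have [w0 w0box w0min] := compact_EVT_min (ex_intro _ _ box0) cbox
  (continuous_subspaceT dual_continuous).
exists w0 => w.
have [i wi] : exists i, forall k, w ord0 i <= w ord0 k.
  have [i _ iP] := @arg_minP _ _ _ (@ord0 n) xpredT (fun k => w ord0 k) isT.
  by exists i => k; exact: iP.
rewrite -(dual_shift w (- w ord0 i)); set w' := w + _.
have w'E k : w' ord0 k = w ord0 k - w ord0 i by rewrite !mxE.
have w'_ge0 k : 0 <= w' ord0 k by rewrite w'E subr_ge0.
have w'i : w' ord0 i = 0 by rewrite w'E subrr.
have [w'box|/existsNP[j]] := pselect (box w').
  by apply: w0min; rewrite inE.
rewrite /= in_itv/= w'_ge0/= => /negP; rewrite -ltNge => Mw'.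
apply: le_trans (w0min 0 _) _; first by rewrite inE.
apply: le_trans (lb w' i j w'_ge0 w'i).
have := MP j; have := ler_norm (dual 0).
have : m j * M <= m j * w' ord0 j by rewrite ler_pM2l// ltW.
lra.
Qed.

Lemma measurable_softmax w i :
  measurable_fun setT (fun y : E => softmax (slopes w y) i).
Proof.
have -> : (fun y : E => softmax (slopes w y) i) =
    (fun y : E => expR (slopes w y i - potential w y)).
  by apply/funext => y; rewrite softmaxE.
apply: (measurableT_comp (@measurable_expR R)).
apply: measurable_funB; last exact: measurable_potential.
apply: measurable_funB => //.
have := integrable_dotv_cst (p i) Pnu => /(measurable_int nu).
by move/measurable_EFinP.
Qed.

Lemma integrable_softmax w i (g : E -> R) : nu.-integrable setT (EFin \o g) ->
  nu.-integrable setT (EFin \o (fun y => softmax (slopes w y) i * g y)).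
Proof.
move=> ig; apply: (integrable_dominated _ _ (integrable_norm ig)).
  apply: measurable_funM; first exact: measurable_softmax.
  by apply/measurable_EFinP; exact: (measurable_int nu ig).
move=> y; rewrite normrM ger0_norm ?softmax_ge0// ler_piMl//.
exact: softmax_le1.
Qed.

Lemma integrable_softmax1 w i :
  nu.-integrable setT (EFin \o (fun y : E => softmax (slopes w y) i)).
Proof.
have := integrable_softmax w i (integrable_cstR nu 1).
by rewrite (_ : (fun y => _ * 1) = (fun y : E => softmax (slopes w y) i))//;
  apply/funext => y; rewrite mulr1.
Qed.

(** The derivative of the dual functional in the direction i is m i minus the
    integral of the i-th softmax weight; one-sided bounds on its increments
    replace differentiation under the integral. *)
Lemma minimizer_marginal w0 : (forall w, dual w0 <= dual w) ->
  forall i, \int[nu]_y softmax (slopes w0 y) i = m i.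
Proof.
move=> w0min i; set q := \int[nu]_y _.
have H t : 0 <= q * (expR (- t) - 1) + m i * t.
  have := w0min (w0 + t *: delta_mx ord0 i); rewrite /dual.
  have h1 : \int[nu]_y potential (w0 + t *: delta_mx ord0 i) y <=
      \int[nu]_y (potential w0 y +
         softmax (slopes w0 y) i * (expR (- t) - 1)).
    apply: le_Rintegral => //.
    - exact: integrable_potential.
    - exact: (integrableD measurableT (integrable_potential w0 Pnu)
        (integrable_softmax w0 i (integrable_cstR nu (expR (- t) - 1)))).
    move=> y _; apply: le_trans (lse_perturb _ _ _).
    rewrite le_eqVlt; apply/orP; left; apply/eqP; congr lse.
    by apply/funext => k; rewrite /slopes !mxE eqxx/= mulrC; ring.
  rewrite RintegralD// in h1; last 2 first.
  - exact: integrable_potential.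
  - exact: (integrable_softmax w0 i (integrable_cstR nu _)).
  rewrite RintegralZr// in h1; last exact: integrable_softmax1.
  have h2 : \sum_k m k * (w0 + t *: delta_mx ord0 i) ord0 k =
      \sum_k m k * w0 ord0 k + m i * t.
    rewrite (eq_bigr (fun k => m k * w0 ord0 k + m k * (t * (k == i)%:R))).
      rewrite big_split/=; congr (_ + _).
      rewrite (bigD1 i)//= eqxx mulr1 big1 ?addr0// => k /negbTE ->.
      by rewrite !mulr0.
    by move=> k _; rewrite !mxE eqxx/= mulrDr.
  by rewrite h2 => h; exact: increment_bound h h1.
have q0 : 0 <= q by apply: Rintegral_ge0 => y _; exact: softmax_ge0.
(* e^(-t) - 1 <= - t / (1 + t) turns H into two one-sided linear bounds *)
have H' t : -1 < t -> 0 <= t * (m i * (1 + t) - q).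
  move=> t1; have t1' : 0 < 1 + t by lra.
  have e1 : expR (- t) <= (1 + t)^-1.
    by rewrite expRN lef_pV2 ?posrE ?expR_gt0// expR_ge1Dx.
  have := ler_wpM2l q0 e1; have := H t => h1 h2.
  have h3 : 0 <= q * (1 + t)^-1 - q + m i * t by lra.
  rewrite (_ : t * _ = (q * (1 + t)^-1 - q + m i * t) * (1 + t)).
    by rewrite pmulr_lge0.
  by field; rewrite gt_eqF.
apply/eqP; rewrite eq_le; apply/andP; split; apply/ler_addgt0Pr => e e0.
- pose t := e / m i; have t0 : 0 < t by exact: divr_gt0.
  have := H' t; rewrite pmulr_rge0// => /(_ (lt_trans (ltrN10 R) t0)).
  by rewrite mulrDr mulr1 /t mulrC divfK ?gt_eqF// subr_ge0.
- pose t := Num.min (2^-1) (e / m i).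
  have t0 : 0 < t by rewrite lt_min invr_gt0 ltr0n divr_gt0.
  have t2 : t <= 2^-1 by rewrite ge_min lexx.
  have te : m i * t <= e.
    by rewrite mulrC -ler_pdivlMr// ge_min lexx orbT.
  have := H' (- t); have -> : -1 < - t by lra.
  by move=> /(_ isT); rewrite mulNr oppr_ge0 pmulr_rle0//; lra.
Qed.

End dual_potential.

Section convex_order_correlation.
Context {R : realType} {d n : nat}.
Local Notation E := (euclid R d).
Variables (nu rho : probability E R).
Hypotheses (Pnu : P2 nu) (Prho : P2 rho) (rho_nu : convex_order rho nu).
Context {dT} {T : measurableType dT} (P : probability T R).
Variables (Z : T -> 'rV[R]_d) (J : T -> 'I_n.+1) (m : 'I_n.+1 -> R).
Hypothesis lZ : has_law P (Z : T -> E) rho.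
Hypothesis mJ : forall i, measurable (J @^-1` [set i]).
Hypothesis PJ : forall i, P (J @^-1` [set i]) = (m i)%:E.
Hypothesis m0 : forall i, 0 < m i.

Let Rintegral_finite (a : 'I_n.+1 -> R) :
  \int[P]_t a (J t) = \sum_i m i * a i.
Proof.
rewrite (_ : \int[P]_t _ = \int[P]_t \sum_i \1_(J @^-1` [set i]) t * a i).
  rewrite /Rintegral; under eq_integral do rewrite -sumEFin.
  rewrite integral_sum//; last first.
    move=> i; under eq_fun do rewrite EFinM.
    by apply: integrableZr => //; exact: integrable_indic.
  rewrite -sum_fine => [|i _].
    apply: eq_bigr => i _; under eq_integral do rewrite mulrC EFinM.
    rewrite integralZl//; last exact: integrable_indic.
    by rewrite integral_indic// setIT [X in fine (_ * X)%E](PJ i) mulrC.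
  under eq_integral do rewrite EFinM.
  apply: integrable_fin_num => //.
  by apply: integrableZr => //; exact: integrable_indic.
by apply: eq_Rintegral => t _; exact: finite_valued_sumE.
Qed.

Let m1 : \sum_i m i = 1.
Proof.
have := Rintegral_finite (fun=> 1); rewrite Rintegral_probability_cst => h.
by rewrite [RHS]h; apply: eq_bigr => i _; rewrite mulr1.
Qed.

(** One potential serves both sides: weak duality bounds the correlation of
    rho with the points p by the dual value, the convex order passes from rho
    to nu, and the optimality condition produces the soft assignment s. *)
Lemma soft_assignment (p : 'I_n.+1 -> 'rV[R]_d) :
  exists s : 'I_n.+1 -> E -> R,
  [/\ forall i, measurable_fun setT (s i),
      forall i y, 0 <= s i y,
      forall y, \sum_i s i y = 1,
      forall i, (\int[nu]_y (s i y)%:E = (m i)%:E)%E &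
      \int[P]_t dotv (p (J t)) (Z t) <=
        \sum_i \int[nu]_y (s i y * dotv (p i) y) + n.+1%:R].
Proof.
have [w wmin] := dual_minimizer Pnu p m0 m1.
have marg := minimizer_marginal Pnu m0 wmin.
exists (fun i y => softmax (slopes p w y) i); split.
- by move=> i; exact: (measurable_softmax Pnu).
- by move=> i y; exact: softmax_ge0.
- by move=> y; exact: sum_softmax.
- move=> i; rewrite -marg /Rintegral fineK//.
  exact: (integrable_fin_num _ (integrable_softmax1 Pnu p w i)).
have sZ := law_square_integrable lZ Prho.
have iphi_rho := integrable_potential p w Prho.
have iphi_nu := integrable_potential p w Pnu.
have sq := square_integrable_finite P p mJ.
have iw : P.-integrable setT (EFin \o (fun t => w ord0 (J t))).
  rewrite (_ : EFin \o _ = fun t =>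
      (\sum_i (\1_(J @^-1` [set i]) t * w ord0 i)%:E)%E); last first.
    apply/funext => t /=; rewrite sumEFin.
    by rewrite (finite_valued_sumE J (fun i => w ord0 i)).
  apply: (integrable_sum measurableT) => i _.
  under eq_fun do rewrite EFinM.
  by apply: integrableZr => //; exact: integrable_indic.
apply: (@le_trans _ _ (\int[P]_t (potential p w (Z t) + w ord0 (J t)))).
  apply: le_Rintegral => //.
  - exact: integrable_dotv.
  - exact: (integrableD measurableT (law_integrable lZ iphi_rho) iw).
  move=> t _; rewrite -lerBlDr.
  exact: (le_lse (slopes p w (Z t)) (J t)).
rewrite RintegralD//; last exact: (law_integrable lZ iphi_rho).
rewrite (Rintegral_finite (fun i => w ord0 i)).
rewrite -(law_Rintegral lZ (measurable_potential p w)).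
have h1 : \int[rho]_y potential p w y <= \int[nu]_y potential p w y.
  apply: fine_le; [exact: integrable_fin_num iphi_rho
    |exact: integrable_fin_num iphi_nu|].
  by apply: rho_nu; exact: potential_convex.
have is_dot i : nu.-integrable setT
    (EFin \o (fun y : E => softmax (slopes p w y) i * dotv (p i) y)).
  by apply: integrable_softmax => //; exact: integrable_dotv_cst.
have isw i : nu.-integrable setT
    (EFin \o (fun y : E => softmax (slopes p w y) i * w ord0 i)).
  by apply: integrable_softmax => //; exact: integrable_cstR.
have is_slope i : nu.-integrable setT
    (EFin \o (fun y : E => softmax (slopes p w y) i * slopes p w y i)).
  have := integrableB measurableT (is_dot i) (isw i).
  by apply: eq_integrable => // y _ /=; rewrite -EFinB -mulrBr.
have h2 : \int[nu]_y potential p w y <=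
    \sum_i \int[nu]_y (softmax (slopes p w y) i * slopes p w y i) + n.+1%:R.
  rewrite -lerBlDr.
  apply: (@le_trans _ _ (\int[nu]_y (potential p w y - n.+1%:R))).
    rewrite RintegralB//; last exact: integrable_cstR.
    by rewrite Rintegral_probability_cst.
  have E1 : \sum_i \int[nu]_y (softmax (slopes p w y) i * slopes p w y i) =
      \int[nu]_y \sum_i softmax (slopes p w y) i * slopes p w y i.
    rewrite [RHS]/Rintegral; under [in RHS]eq_integral do rewrite -sumEFin.
    rewrite integral_sum// -sum_fine// => i _.
    by apply: integrable_fin_num => //; exact: is_slope.
  rewrite E1; apply: le_Rintegral => //.
  - exact: (integrableB measurableT iphi_nu (integrable_cstR nu n.+1%:R)).
  - rewrite (_ : EFin \o _ = fun y => (\sum_i (softmax (slopes p w y) i *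
      slopes p w y i)%:E)%E).
      by apply: (integrable_sum measurableT) => i _; exact: is_slope.
    by apply/funext => y; rewrite sumEFin.
  by move=> y _; exact: softmax_mean_ge.
have h3 i : \int[nu]_y (softmax (slopes p w y) i * slopes p w y i) =
    \int[nu]_y (softmax (slopes p w y) i * dotv (p i) y) - m i * w ord0 i.
  rewrite -(marg i) -RintegralZr//; last exact: integrable_softmax1.
  rewrite -RintegralB//.
  by apply: eq_Rintegral => y _; rewrite /slopes mulrBr.
rewrite (eq_bigr _ (fun i _ => h3 i)) sumrB in h2.
lra.
Qed.

End convex_order_correlation.

(** * Projections in convex order *)

Section projection.
Context {R : realType} {d : nat}.
Local Notation E := (euclid R d).

Definition root_second_moment (alpha : probability E R) : R :=
  norm2 alpha (fun x : E => (x : 'rV[R]_d)).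

Lemma norm2_law {dT} {T : measurableType dT} (P : probability T R)
    (X : T -> 'rV[R]_d) alpha :
  has_law P (X : T -> E) alpha -> norm2 P X = root_second_moment alpha.
Proof. by move=> lX; rewrite /root_second_moment -(norm2_comp lX). Qed.

Lemma backward_projection_W2_real_le (nu mu rho : probability E R) :
  P2 nu -> P2 mu -> backward_projection nu mu rho ->
  W2_real rho mu <= W2_real nu mu.
Proof.
move=> Pnu Pmu [[Prho _] rmin].
have : (W2sq rho mu <= W2sq nu mu)%E by apply: rmin; split.
by rewrite !W2sqE// lee_fin ler_sqr// nnegrE W2_real_ge0.
Qed.

Section variational_inequality.
Variables (nu mu rho : probability E R).
Hypotheses (Pnu : P2 nu) (Pmu : P2 mu).
Hypothesis prho : backward_projection nu mu rho.
Context {dT} {T : measurableType dT} (P : probability T R).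
Variables (Z X : T -> 'rV[R]_d) (eta : R).
Hypotheses (lZ : has_law P (Z : T -> E) rho) (lX : has_law P (X : T -> E) mu).
Hypotheses (eta0 : 0 < eta) (eta1 : eta <= 1).
Hypothesis near_opt :
  norm2 P (fun t => Z t - X t) ^+ 2 <= W2_real rho mu ^+ 2 + eta ^+ 2.

(** First-order condition for the projection onto a convex set of L2: the
    competitor is Z moved by the fraction eta towards V. *)
Lemma projection_variational (V : T -> 'rV[R]_d) :
  has_law P (V : T -> E) nu ->
  inner P (fun t => X t - Z t) (fun t => V t - Z t)
    <= eta * (1 + (root_second_moment nu + root_second_moment rho) ^+ 2).
Proof.
move=> lV; have [[Prho rho_nu] rmin] := prho.
have sZ := law_square_integrable lZ Prho.
have sX := law_square_integrable lX Pmu.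
have sV := law_square_integrable lV Pnu.
pose S t := eta *: V t + (1 - eta) *: Z t.
have sS : square_integrable P S.
  by apply: square_integrableD; exact: square_integrableZ.
have [sigma lS] := has_law_distribution P sS.1.
have [Psigma sigma_nu] := convex_order_interpolation (ltW eta0) eta1 Pnu Prho
  rho_nu lV lZ lS.
have le_sigma : W2_real rho mu ^+ 2 <= W2_real sigma mu ^+ 2.
  by rewrite -lee_fin -!W2sqE//; exact: rmin.
have := le_trans le_sigma (sqr_W2_real_le Psigma Pmu lS lX).
have sXZ := square_integrableB sX sZ; have sVZ := square_integrableB sV sZ.
rewrite -sqr_norm2 norm2BC sqr_norm2.
have -> : (fun t => X t - S t) = (fun t => (X t - Z t) - eta *: (V t - Z t)).
  by apply/funext => t; apply/rowP => i; rewrite /S !mxE; ring.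
rewrite inner_subZ// -!sqr_norm2 (norm2BC P X Z) => h.
have VZ : norm2 P (fun t => V t - Z t) ^+ 2 <=
    (root_second_moment nu + root_second_moment rho) ^+ 2.
  rewrite ler_sqr ?nnegrE ?norm2_ge0 ?addr_ge0 ?norm2_ge0//.
  rewrite -(norm2_law lV) -(norm2_law lZ).
  exact: norm2B.
have : 2 * eta * inner P (fun t => X t - Z t) (fun t => V t - Z t) <=
    eta * (eta * (1 + (root_second_moment nu + root_second_moment rho) ^+ 2)).
  have := ler_wpM2l (sqr_ge0 eta) VZ; have := near_opt; lra.
rewrite [2 * eta]mulrC -mulrA ler_pM2l//.
have : 0 <= eta * (1 + (root_second_moment nu + root_second_moment rho) ^+ 2).
  by rewrite mulr_ge0 ?(ltW eta0)// addr_ge0// sqr_ge0.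
lra.
Qed.

End variational_inequality.
End projection.

(** * Stability of the backward projection *)

Section key_inequality.
Context {R : realType} {d : nat}.
Local Notation E := (euclid R d).
Variables (nu mu rho nu' rho' : probability E R).
Hypotheses (Pnu : P2 nu) (Pmu : P2 mu) (Pnu' : P2 nu') (Prho' : P2 rho').
Hypothesis prho : backward_projection nu mu rho.
Hypothesis rho_nu' : convex_order rho' nu'.
Context {dT} {T : measurableType dT} (P : probability T R).
Variables (Z X W : T -> 'rV[R]_d) (eta : R).
Hypotheses (lZ : has_law P (Z : T -> E) rho) (lX : has_law P (X : T -> E) mu).
Hypothesis lW : has_law P (W : T -> E) rho'.
Hypotheses (eta0 : 0 < eta) (eta1 : eta <= 1).
Hypothesis near_opt :
  norm2 P (fun t => Z t - X t) ^+ 2 <= W2_real rho mu ^+ 2 + eta ^+ 2.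

(** Were W of law nu, the variational inequality would make the left-hand side
    nonpositive up to the error in eta. The soft assignment replaces W by some Y' of
    law nu', and a near-optimal coupling of (nu, nu') replaces Y' by some Y of
    law nu, to which that inequality applies; only the second replacement has
    a cost that survives in the limit. *)
Lemma projection_cross_inequality :
  inner P (fun t => X t - Z t) (fun t => W t - Z t) <=
    norm2 P (fun t => X t - Z t) * W2_real nu nu' +
    eta * (1 + (root_second_moment nu + root_second_moment rho) ^+ 2).
Proof.
have Prho : P2 rho by case: prho => -[].
have sZ := law_square_integrable lZ Prho.
have sX := law_square_integrable lX Pmu.
have sW := law_square_integrable lW Prho'.
pose D t := X t - Z t; have sD : square_integrable P D.
  exact: square_integrableB.
rewrite -[X in inner P X _]/D -[X in norm2 P X]/D.
set err := eta * _; apply/ler_addgt0Pr => e e0.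
pose K := root_second_moment rho' + root_second_moment nu' + norm2 P D + 1.
have rho'0 : 0 <= root_second_moment rho' by exact: norm2_ge0.
have nu'0 : 0 <= root_second_moment nu' by exact: norm2_ge0.
have D0 : 0 <= norm2 P D by exact: norm2_ge0.
have K0 : 0 < K by rewrite /K; lra.
pose delta := e / K; have delta0 : 0 < delta by exact: divr_gt0.
have deltaK : delta * K = e by rewrite /delta divfK// gt_eqF.
have [[|n] [q [J [m [mJ PJ m0 qJ]]]]] := discretize sD delta0.
  by case: (J point).
(* the points are rescaled so that the entropic error n + 1 becomes delta *)
pose lambda := n.+1%:R / delta.
have lambda0 : 0 < lambda by rewrite divr_gt0.
have [s [ms s0 s1 sm corr]] := soft_assignment Pnu' Prho' rho_nu' lW mJ PJ m0
  (fun i => lambda *: q i).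
have [pi [l1 l2 piD]] := near_optimal_norm Pnu Pnu' delta0.
pose sp i (z : E * E) := s i (proj2v z).
have msp i : measurable_fun setT (sp i).
  exact: (measurableT_comp (ms i) measurable_snd).
have smp i : (\int[pi]_z (sp i z)%:E = (m i)%:E)%E.
  rewrite -sm (law_integral l2)//.
  by apply/measurable_EFinP; exact: ms.
have [Q [lQ1 lQ2 QJ]] := glue_soft mJ PJ m0 msp (fun i z => s0 i (proj2v z))
  (fun z => s1 (proj2v z)) smp.
have sq := square_integrable_finite P q mJ.
have kZ := has_law_comp lQ1 lZ; have kX := has_law_comp lQ1 lX.
have kY := has_law_comp lQ2 l1; have kY' := has_law_comp lQ2 l2.
pose qQ (z : T * (E * E)) := q (J z.1); pose DQ (z : T * (E * E)) := D z.1.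
pose Y (z : T * (E * E)) := proj1v z.2; pose Y' (z : T * (E * E)) := proj2v z.2.
have sqQ : square_integrable Q qQ := square_integrable_comp lQ1 sq.
have sDQ : square_integrable Q DQ := square_integrable_comp lQ1 sD.
have sY : square_integrable Q Y := law_square_integrable kY Pnu.
have sY' : square_integrable Q Y' := law_square_integrable kY' Pnu'.
have sZQ := law_square_integrable kZ Prho.
have normDQ : norm2 Q DQ = norm2 P D := norm2_comp lQ1 sD.1.
have step1 : inner P D W <= inner P (fun t => q (J t)) W
    + delta * root_second_moment rho'.
  rewrite -lerBlDl -innerBl//.
  apply: le_trans (cauchy_schwarz (square_integrableB sD sq) sW) _.
  by rewrite (norm2_law lW) ler_wpM2r.
have step2 : inner P (fun t => q (J t)) W <= inner Q qQ Y' + delta.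
  have -> : inner Q qQ Y' = \sum_i \int[nu']_y (s i y * dotv (q i) y).
    rewrite /inner (glue_Rintegral mJ msp (fun i z => s0 i (proj2v z))
      (fun z => s1 (proj2v z)) (G := fun i z => dotv (q i) (proj2v z)) QJ).
      apply: eq_bigr => i _; rewrite (law_Rintegral l2)//.
      apply: measurable_funM => //.
      apply/measurable_EFinP.
      exact: (measurable_int nu' (integrable_dotv_cst (q i) Pnu')).
    move=> i; exact: (law_integrable l2 (integrable_dotv_cst (q i) Pnu')).
  rewrite -(ler_pM2l lambda0) mulrDr -innerZl// [lambda * delta]divfK ?gt_eqF//.
  apply: le_trans corr _; rewrite lerD2r mulr_sumr; apply: ler_sum => i _.
  rewrite -RintegralZl//.
    rewrite le_eqVlt; apply/orP; left; apply/eqP.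
    by apply: eq_Rintegral => y _; rewrite dotvZl mulrCA.
  have idot := integrable_dotv_cst (q i) Pnu'.
  apply: (integrable_dominated _ _ (integrable_norm idot)).
    apply: measurable_funM => //.
    by apply/measurable_EFinP; exact: (measurable_int nu' idot).
  move=> y; rewrite normrM (ger0_norm (s0 i y)) ler_piMl//.
  by rewrite -(s1 y) (bigD1 i)//= lerDl; apply: sumr_ge0.
have step3 : inner Q qQ Y' <= inner Q DQ Y' + delta * root_second_moment nu'.
  rewrite -lerBlDl -innerBl//.
  apply: le_trans (cauchy_schwarz (square_integrableB sqQ sDQ) sY') _.
  rewrite (norm2_law kY') norm2BC.
  by rewrite (norm2_comp lQ1 (square_integrableB sD sq).1) ler_wpM2r.
have step4 : inner Q DQ Y' <= inner Q DQ Y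
    + norm2 P D * (W2_real nu nu' + delta).
  rewrite -lerBlDl -innerBr//.
  apply: le_trans (cauchy_schwarz sDQ (square_integrableB sY' sY)) _.
  rewrite normDQ norm2BC.
  rewrite (norm2_comp lQ2 (measurable_rvB measurable_proj1v measurable_proj2v)).
  exact: ler_wpM2l.
have step5 : inner Q DQ Y <= inner P D Z + err.
  rewrite -(inner_comp lQ1 sD.1 sZ.1) -lerBlDl.
  have := projection_variational Pnu Pmu prho kZ kX eta0 eta1 _ kY.
  rewrite (norm2_comp lQ1 (square_integrableB sZ sX).1) => /(_ near_opt).
  by rewrite innerBr.
rewrite innerBr// -deltaK /K.
exact: (telescoped_bound step1 step2 step3 step4 step5).
Qed.

End key_inequality.

Section stability.
Context {R : realType} {d : nat}.
Local Notation E := (euclid R d).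
Variables (mu mu' nu nu' rho rho' : probability E R).
Hypotheses (Pmu : P2 mu) (Pmu' : P2 mu') (Pnu : P2 nu) (Pnu' : P2 nu').
Hypotheses (prho : backward_projection nu mu rho)
  (prho' : backward_projection nu' mu' rho').

(** The three scalar products of the splitting are bounded separately. The
    constant K is independent of eta, whereas a, the L2 distance between the
    two projections, depends on the near-optimal couplings chosen. *)
Lemma projection_stability_approx : exists K, 0 <= K /\
  forall eta, 0 < eta -> eta <= 1 ->
  exists a, [/\ W2_real rho rho' <= a, 0 <= a &
    a ^+ 2 <= (W2_real mu mu' + 3 * eta) * a +
      W2_real nu nu' * (W2_real mu nu + W2_real mu nu' + W2_real mu mu') + eta * K].
Proof.
pose K1 := 1 + (root_second_moment nu + root_second_moment rho) ^+ 2.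
pose K2 := 1 + (root_second_moment nu' + root_second_moment rho') ^+ 2.
have K1_ge0 : 0 <= K1 by rewrite addr_ge0// sqr_ge0.
have K2_ge0 : 0 <= K2 by rewrite addr_ge0// sqr_ge0.
have eps0 := W2_real_ge0 nu nu'.
exists (K1 + K2 + 2 * W2_real nu nu'); split; first lra.
move=> eta eta0 eta1.
have [[Prho rho_nu] _] := prho; have [[Prho' rho_nu'] _] := prho'.
have eta20 : 0 < eta ^+ 2 by exact: exprn_gt0.
have [pi1 [l1 l2 h1]] := near_optimal_coupling Prho Pmu eta20.
have [pi2 [l3 l4 h2]] := near_optimal_norm Pmu Pmu' eta0.
have [pi3 [l5 l6 h3]] := near_optimal_coupling Prho' Pmu' eta20.
have [Q12 [k1 k2 glue12]] := approximate_gluing Pmu l2 l3 eta0.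
have [Q [kQ k3 glue23]] :=
  approximate_gluing Pmu' (has_law_comp k2 l4) l6 eta0.
have q1 := has_law_comp kQ k1; have q2 := has_law_comp kQ k2.
have lZ := has_law_comp q1 l1; have lX := has_law_comp q1 l2.
have lX1 := has_law_comp q2 l3; have lX2 := has_law_comp q2 l4.
have lZ' := has_law_comp k3 l5; have lX' := has_law_comp k3 l6.
set Z := (fun u => _) in lZ; set X := (fun u => _) in lX.
set X1 := (fun u => _) in lX1; set X2 := (fun u => _) in lX2.
set Z' := (fun u => _) in lZ'; set X' := (fun u => _) in lX'.
have sZ := law_square_integrable lZ Prho.
have sX := law_square_integrable lX Pmu.
have sX1 := law_square_integrable lX1 Pmu.
have sX2 := law_square_integrable lX2 Pmu'.
have sZ' := law_square_integrable lZ' Prho'.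
have sX' := law_square_integrable lX' Pmu'.
have m12 : measurable_fun setT
    ((fun z : E * E => proj1v z - proj2v z) : E * E -> E).
  exact: measurable_rvB measurable_proj1v measurable_proj2v.
have n1 : norm2 Q (fun u => Z u - X u) ^+ 2 <= W2_real rho mu ^+ 2 + eta ^+ 2.
  by rewrite (norm2_comp q1 m12).
have n2 : norm2 Q (fun u => X1 u - X2 u) <= W2_real mu mu' + eta.
  by rewrite (norm2_comp q2 m12).
have n3 : norm2 Q (fun u => Z' u - X' u) ^+ 2 <= W2_real rho' mu' ^+ 2 + eta ^+ 2.
  by rewrite (norm2_comp k3 m12).
have n4 : norm2 Q (fun u => X u - X1 u) <= eta.
  apply: le_trans glue12.
  rewrite (@norm2_comp _ _ _ _ _ _ _ _ _ kQ
    (fun z => proj2v z.1 - proj1v z.2))//.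
  apply: measurable_rvB.
    exact: (measurableT_comp measurable_proj2v measurable_fst).
  exact: (measurableT_comp measurable_proj1v measurable_snd).
pose a := norm2 Q (fun u => Z u - Z' u).
exists a; split; [exact: W2_real_le|exact: norm2_ge0|].
have r1 : norm2 Q (fun u => X u - Z u) <= W2_real mu nu + eta.
  rewrite norm2BC (W2_real_sym Pmu Pnu).
  apply: le_trans (sqrt_excess (W2_real_ge0 _ _) eta0 n1) _.
  by rewrite lerD2r; exact: backward_projection_W2_real_le.
have r2 : norm2 Q (fun u => X' u - Z' u) <=
    W2_real mu mu' + W2_real mu nu' + eta.
  rewrite norm2BC.
  apply: le_trans (sqrt_excess (W2_real_ge0 _ _) eta0 n3) _.
  rewrite lerD2r.
  apply: le_trans (backward_projection_W2_real_le Pnu' Pmu' prho') _.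
  rewrite (W2_real_sym Pnu' Pmu') (W2_real_sym Pmu Pmu').
  exact: W2_real_triangle.
have c1 := projection_cross_inequality Pnu Pmu Pnu' Prho' prho rho_nu'
  lZ lX lZ' eta0 eta1 n1.
have c2 := projection_cross_inequality Pnu' Pmu' Pnu Prho prho' rho_nu
  lZ' lX' lZ eta0 eta1 n3.
rewrite (W2_real_sym Pnu' Pnu) in c2.
have middle : inner Q (fun u => X u - X' u) (fun u => Z u - Z' u) <=
    (W2_real mu mu' + 3 * eta) * a.
  apply: le_trans (cauchy_schwarz (square_integrableB sX sX')
    (square_integrableB sZ sZ')) _.
  rewrite ler_wpM2r ?norm2_ge0//.
  exact: (three_step_bound (norm2_dist sX sX1 sX') (norm2_dist sX1 sX2 sX')
    n4 n2 glue23).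
rewrite (sqr_norm2_split sZ sX sX' sZ').
rewrite -/K1 in c1; rewrite -/K2 in c2.
exact: (quadratic_bound eps0 c1 c2 middle r1 r2).
Qed.

(** Were the claimed bound exceeded by b, the quadratic inequality would fail
    for a = b by the margin c; it fails a fortiori for a >= b, and eta is chosen
    so small that the error terms stay below this margin. *)
Lemma projection_stability : W2_real rho rho' <=
  W2_real mu mu' + Num.sqrt ((W2_real mu nu + W2_real mu nu') * W2_real nu nu').
Proof.
have [K [K0 H]] := projection_stability_approx.
set b := W2_real rho rho'; set D := W2_real mu mu'; set eps := W2_real nu nu'.
set S := W2_real mu nu + W2_real mu nu'; set s := Num.sqrt _.
have D0 : 0 <= D := W2_real_ge0 _ _; have eps0 : 0 <= eps := W2_real_ge0 _ _.
have S0 : 0 <= S by rewrite addr_ge0// W2_real_ge0.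
have s0 : 0 <= s := sqrtr_ge0 _.
have ss : s ^+ 2 = S * eps by rewrite sqr_sqrtr// mulr_ge0.
have epsS : eps <= S.
  by rewrite /S (W2_real_sym Pmu Pnu); exact: W2_real_triangle.
have eps_s : eps <= s.
  by rewrite -ler_sqr ?nnegrE// ss expr2 ler_wpM2r.
rewrite leNgt; apply/negP => bDs.
pose c := b ^+ 2 - D * b - eps * (S + D).
have c0 : 0 < c.
  have : 0 < (b - (D + s)) * (b + s) by rewrite mulr_gt0//; lra.
  by have := ler_wpM2l D0 eps_s; rewrite /c; nra.
have b0 : 0 < b by lra.
have Kb : 0 < K + 3 * b + 1 by lra.
pose eta := Num.min 1 (Num.min ((b - D) / 3) (c / (2 * (K + 3 * b + 1)))).
have eta0 : 0 < eta.
  rewrite !lt_min ltr01/= divr_gt0 ?divr_gt0 ?mulr_gt0//; lra.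
have eta1 : eta <= 1 by rewrite ge_min lexx.
have eta2 : 3 * eta <= b - D.
  have : eta <= (b - D) / 3 by rewrite !ge_min lexx !orbT.
  by lra.
have eta3 : eta * (K + 3 * b + 1) <= c / 2.
  rewrite -ler_pdivlMr// -mulrA -invfM.
  by rewrite !ge_min lexx !orbT.
have [a [ba a0]] := H eta eta0 eta1.
rewrite -/D -/eps -/S => h; rewrite -/b in ba.
have : 0 <= (a - b) * (a + b - D - 3 * eta) by rewrite mulr_ge0//; lra.
rewrite /c in c0 eta3; nra.
Qed.

End stability.

Local Open Scope ereal_scope.

Theorem proposition4 (R : realType) (d : nat) (hd : (1 <= d)%N)
    (mu mu' nu nu' : probability (euclid R d) R)
    (hmu : P2 mu) (hmu' : P2 mu') (hnu : P2 nu) (hnu' : P2 nu')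
    (rho rho' : probability (euclid R d) R)
    (hrho : backward_projection nu mu rho)
    (hrho' : backward_projection nu' mu' rho') :
  W2 rho rho' <=
    W2 mu mu' + sqrte ((W2 mu nu + W2 mu nu') * W2 nu nu').
Proof.
have [[Prho _] _] := hrho; have [[Prho' _] _] := hrho'.
rewrite !W2E//.
have := projection_stability hmu hmu' hnu hnu' hrho hrho'.
by rewrite -lee_fin EFinD.
Qed.
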